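(* Let $k\ge1$ be an integer, $c\in\mathbb{C}$ a constant and $\beta\in\mathbb{R}$ with $|\beta|\ge1$. For any $f\in L^2(\mathbb{C},e^{-|z|^2})$ there exists a weak solution $u\in L^2(\mathbb{C},e^{-|z|^2})$ of the equation $$\beta\,\bar\partial^k u+cu=\beta f$$ with $$\int_{\mathbb{C}}|u|^2e^{-|z|^2}\,d\sigma\le\frac{|\beta|^2}{k!}\int_{\mathbb{C}}|f|^2e^{-|z|^2}\,d\sigma .$$
   Context: $\bar\partial=\partial/\partial\bar z$, $\bar\partial^k$ is its $k$-th iterate, and $d\sigma$ is Lebesgue measure on $\mathbb{C}$. $L^2(\mathbb{C},e^{-|z|^2})$ is the space of $f\in L^2_{loc}(\mathbb{C})$ with $\int_{\mathbb{C}}|f|^2e^{-|z|^2}d\sigma<\infty$. A function $u\in L^2_{loc}(\mathbb{C})$ is a weak solution of $\beta\bar\partial^ku+cu=g$ if $\int_{\mathbb{C}}u\,\big((-1)^k\beta\,\bar\partial^k\phi+c\,\phi\big)d\sigma=\int_{\mathbb{C}}g\phi\,d\sigma$ for all smooth compactly supported $\phi:\mathbb{C}\to\mathbb{C}$. *)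

(* Defs.v *)
From HB Require Import structures.
From mathcomp Require Import all_boot all_order all_algebra.
From mathcomp Require Import all_classical all_reals all_analysis.
From mathcomp Require Import complex.

Set Implicit Arguments.
Unset Strict Implicit.
Unset Printing Implicit Defensive.

Import Order.TTheory GRing.Theory Num.Theory.
Import numFieldNormedType.Exports.

Local Open Scope classical_set_scope.
Local Open Scope ring_scope.
Local Open Scope complex_scope.

(* The library puts no topology or sigma-algebra over R : realType on R[i].
   Functions on the complex plane have type R[i] -> R[i]; their analytic and
   measure-theoretic properties are read off after precomposition with the
   identification (x, y) |-> x + iy of R^2 with the plane. *)
Definition plane (R : realType) : Type :=
  (measurableTypeR R * measurableTypeR R)%type.

Definition toC (R : realType) (p : R * R) : R[i] := p.1 +i* p.2.

Definition ofC (R : realType) (z : R[i]) : R * R := (complex.Re z, complex.Im z).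

Definition re_part (R : realType) (f : R[i] -> R[i]) (p : R * R) : R :=
  complex.Re (f (toC p)).

Definition im_part (R : realType) (f : R[i] -> R[i]) (p : R * R) : R :=
  complex.Im (f (toC p)).

(* The norm of R[i] takes its (real) values in R[i]. *)
Definition cabs (R : realType) (z : R[i]) : R := complex.Re `|z|.

Definition dsigma (R : realType) : {measure set plane R -> \bar R} :=
  ((@lebesgue_measure R) \x (@lebesgue_measure R))%E.

(* Only meaningful when both parts of f are integrable. *)
Definition Cintegral (R : realType) (f : R[i] -> R[i]) : R[i] :=
  (\int[dsigma R]_p re_part f p) +i* (\int[dsigma R]_p im_part f p).

(* Measurability is Borel measurability: elements of L^2 are represented by
   Borel functions, and every Lebesgue measurable function is a.e. equal to
   one. *)
Definition Cmeasurable (R : realType) (f : R[i] -> R[i]) : Prop :=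
  measurable_fun [set: plane R] (re_part f : plane R -> measurableTypeR R) /\
  measurable_fun [set: plane R] (im_part f : plane R -> measurableTypeR R).

Definition L2loc (R : realType) (f : R[i] -> R[i]) : Prop :=
  Cmeasurable f /\
  forall K : set (R * R), compact K ->
    (\int[dsigma R]_(p in K) (cabs (f (toC p)) ^+ 2)%:E < +oo)%E.

Definition weighted_sqnorm (R : realType) (f : R[i] -> R[i]) : \bar R :=
  (\int[dsigma R]_p
     (cabs (f (toC p)) ^+ 2 * expR (- cabs (toC p) ^+ 2))%:E)%E.

Definition L2weighted (R : realType) (f : R[i] -> R[i]) : Prop :=
  L2loc f /\ (weighted_sqnorm f < +oo)%E.

Definition partial (R : realType) (v : R * R) (f : R[i] -> R[i]) (z : R[i]) :
    R[i] :=
  ('D_v (re_part f) (ofC z)) +i* ('D_v (im_part f) (ofC z)).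

Definition dbar (R : realType) (f : R[i] -> R[i]) (z : R[i]) : R[i] :=
  (partial (1, 0) f z + 'i * partial (0, 1) f z) / 2.

Fixpoint of_class_C (R : realType) (n : nat) (f : R * R -> R) : Prop :=
  if n is m.+1 then
    [/\ continuous f,
        forall p, derivable f p (1, 0),
        forall p, derivable f p (0, 1),
        of_class_C m ('D_((1, 0) : R * R) f) &
        of_class_C m ('D_((0, 1) : R * R) f)]
  else continuous f.

Definition smooth (R : realType) (f : R[i] -> R[i]) : Prop :=
  forall n, of_class_C n (re_part f) /\ of_class_C n (im_part f).

Definition compactly_supported (R : realType) (f : R[i] -> R[i]) : Prop :=
  compact (closure [set p : R * R | f (toC p) != 0]).

Definition weak_solution (R : realType) (k : nat) (beta : R) (c : R[i])
    (g u : R[i] -> R[i]) : Prop :=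
  L2loc u /\
  forall phi : R[i] -> R[i], smooth phi -> compactly_supported phi ->
    Cintegral (fun z =>
      u z * ((-1) ^+ k * beta%:C * iter k (@dbar R) phi z + c * phi z)) =
    Cintegral (fun z => g z * phi z).

(* Main.v *)
From HB Require Import structures.
Require Import Defs.
From mathcomp Require Import all_boot all_order all_algebra.
From mathcomp Require Import all_classical all_reals all_analysis.
From mathcomp Require Import complex.
From mathcomp Require Import measurable_realfun ring lra.

(** Equip the test functions with the norm of weight [e^{|z|^2}].  There the
    adjoint of [D = dbar] is [a = - (d/dz + conj z)], and [a D = D a + 1]: these are
    creation and annihilation operators, so
    [|D^k v|^2 >= |a^k v|^2 + k! |v|^2].  The equation is tested against
    [H v] with [H = (-1)^k beta D^k + c], whose adjoint is
    [H' = (-1)^k beta a^k + conj c].  The cross terms of [|H v|^2] and [|H' v|^2]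
    agree, hence [|H v|^2 >= beta^2 k! |v|^2].  By Cauchy-Schwarz the functional
    [v |-> \int beta f v] is then bounded for the norm [|H v|], with squared
    constant [|f|^2 / k!]; it is represented by an [L^2] limit of some [H v_n],
    whose conjugate times the weight is the solution [u].  Complex functions are
    handled as pairs of real ones, with the real part of the scalar product. *)

(** Since [c] is arbitrary, the cross term of [|H v|^2] has no sign and cannot be absorbed. It is
    cancelled instead of estimated: moving [D^k] across the product turns the pairing of [D^k v]
    with [c v] into that of [a^k v] with [conj c v], because [a] commutes with constants. Hence [|H
    v|^2 - |H' v|^2 = beta^2 (|D^k v|^2 - |a^k v|^2)] does not involve [c], and dropping [|H' v|^2]
    gives a bound uniform in [c]. The weight on test functions grows because it is dual to
    [e^{-|z|^2}]: the unweighted pairing of [f] with [v] is at most the product of the two weighted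
    norms, and compact support keeps the integrals finite. In the squared constant, the [beta^2] of
    the right-hand side cancels the [beta^2] of the coercivity estimate; the factor [|beta|^2] of
    the statement comes from [1 <= |beta|] at the very end. Real parts alone would give only half of
    the weak equation. As [H] commutes with multiplication by [i], testing against [- i v] yields
    the other half. *)

Set Implicit Arguments.
Unset Strict Implicit.
Unset Printing Implicit Defensive.

Import Order.TTheory GRing.Theory Num.Theory.
Import numFieldNormedType.Exports.

Local Open Scope classical_set_scope.
Local Open Scope ring_scope.

(** * Creation and annihilation operators *)

Section ladder.
Context (R : realFieldType) (V : lmodType R) (ip : V -> V -> R).
Context (D a : V -> V).
Hypothesis ipC : forall x y, ip x y = ip y x.
Hypothesis ipDl : forall x y z, ip (x + y) z = ip x z + ip y z.
Hypothesis ipZl : forall t x y, ip (t *: x) y = t * ip x y.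
Hypothesis ip_ge0 : forall x, 0 <= ip x x.
Hypothesis DD : {morph D : x y / x + y}.
Hypothesis DZ : forall t x, D (t *: x) = t *: D x.
Hypothesis adj : forall x y, ip (D x) y = ip x (a y).
Hypothesis comm : forall x, a (D x) = D (a x) + x.

Let ipDr x y z : ip x (y + z) = ip x y + ip x z.
Proof. by rewrite ipC ipDl ipC (ipC z). Qed.

Let ipZr t x y : ip x (t *: y) = t * ip x y.
Proof. by rewrite ipC ipZl ipC. Qed.

Lemma ladder_comm_iter k x :
  a (iter k.+1 D x) = iter k.+1 D (a x) + (k.+1)%:R *: iter k D x.
Proof.
elim: k => [|k IH]; first by rewrite /= comm scale1r.
rewrite [iter k.+2 D x]iterS comm IH DD DZ.
by rewrite -addrA -[k.+2%:R]natr1 scalerDl scale1r.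
Qed.

(** Moving one [D] to the right and commuting it through [D^k] leaves a square plus a nonnegative
    multiple of the same product for [k - 1]. *)
Lemma ladder_cross_ge0 k x : 0 <= ip (iter k.+1 D (a x)) (iter k D x).
Proof.
elim: k x => [|k IH] x /=; first by rewrite adj.
rewrite adj -iterS ladder_comm_iter ipDr ipZr addr_ge0 //.
by rewrite mulr_ge0 // ler0n.
Qed.

(** With [u = D^(k+1) x], the commutator gives [|D u|^2 = |a u|^2 + |u|^2], and [a u] is a sum of
    two terms whose cross product is nonnegative by [ladder_cross_ge0]. *)
Lemma ladder_step k x :
  ip (iter k.+1 D (a x)) (iter k.+1 D (a x)) +
  k.+1%:R ^+ 2 * ip (iter k D x) (iter k D x) +
  ip (iter k.+1 D x) (iter k.+1 D x) <=
  ip (iter k.+2 D x) (iter k.+2 D x).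
Proof.
rewrite [iter k.+2 D x]iterS; set u := iter k.+1 D x.
have -> : ip (D u) (D u) = ip (a u) (a u) + ip u u.
  by rewrite adj comm ipDr (ipC u) adj.
rewrite lerD2r /u ladder_comm_iter !(ipDl, ipDr, ipZl, ipZr).
rewrite (ipC (iter k D x)).
have := mulr_ge0 (ler0n R k.+1) (ladder_cross_ge0 k x).
set c := ip (iter k.+1 D _) (iter k D x) => c0.
by rewrite expr2 -!mulrA; nra.
Qed.

(** Strong induction through [ladder_step], used at [a x] for the [a]-power and at [x] for two lower
    powers of [D]. The factorial arises from [(m+1)^2 m! + (m+1)! = (m+2) (m+1)! = (m+2)!]. *)
Lemma ladder_gap k x :
  ip (iter k.+1 a x) (iter k.+1 a x) + k.+1`!%:R * ip x x <=
    ip (iter k.+1 D x) (iter k.+1 D x).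
Proof.
elim/ltn_ind: k x => -[|m] IH x.
  by rewrite /= mul1r [ip (D x) _]adj comm ipDr (ipC x) adj.
have sm : m.+1`!%:R * ip x x <= ip (iter m.+1 D x) (iter m.+1 D x).
  by apply: le_trans (IH m _ x) => //; rewrite lerDr.
have sm' : m`!%:R * ip x x <= ip (iter m D x) (iter m D x).
  case: m IH {sm} => [|m] IH; first by rewrite mul1r.
  by apply: le_trans (IH m _ x) => //; rewrite lerDr.
apply: le_trans (ladder_step m x).
have am := IH m (ltnSn _) (a x).
rewrite -!iterSr in am.
rewrite [m.+2`!]factS natrM -[m.+2%:R]natr1 mulrDl mul1r mulrDl addrA.
rewrite lerD // lerD //.
  by apply: le_trans am; rewrite lerDl mulr_ge0.
by rewrite factS natrM expr2 -!mulrA ler_wpM2l // ler_wpM2l.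
Qed.

(** [M] stands for multiplication by [c] and [M'] for multiplication by its conjugate. *)
Context (M M' : V -> V).
Hypothesis adjM : forall x y, ip (M x) y = ip x (M' y).
Hypothesis MC : forall x, M (M' x) = M' (M x).
Hypothesis aM : forall x, a (M x) = M (a x).

(* [|(b D^k + M) x|^2 - |(b a^k + M') x|^2 = b^2 (|D^k x|^2 - |a^k x|^2)],
   since the cross terms and the zeroth order terms agree. *)
Lemma ladder_coercive k b x :
  b ^+ 2 * k.+1`!%:R * ip x x <=
    ip (b *: iter k.+1 D x + M x) (b *: iter k.+1 D x + M x).
Proof.
set H := b *: _ + _.
have aMn n y : iter n a (M y) = M (iter n a y).
  by elim: n => //= n ->; rewrite aM.
have adjn n y z : ip (iter n D y) z = ip y (iter n a z).
  by elim: n y z => //= n IH y z; rewrite adj IH -iterSr.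
pose G := b *: iter k.+1 a x + M' x.
have cross : ip (iter k.+1 D x) (M x) = ip (iter k.+1 a x) (M' x).
  by rewrite adjn aMn ipC adjM.
have MM : ip (M x) (M x) = ip (M' x) (M' x).
  by rewrite adjM -MC ipC adjM.
have HG : ip H H = ip G G + b ^+ 2 * (ip (iter k.+1 D x) (iter k.+1 D x) -
    ip (iter k.+1 a x) (iter k.+1 a x)).
  rewrite /H /G !(ipDl, ipDr, ipZl, ipZr) (ipC (M x)) (ipC (M' x)) cross MM.
  by ring.
have := ladder_gap k x; have := ip_ge0 G; rewrite HG -lerBrDl => G0 gap.
rewrite -mulrA; apply: le_trans (ler_wpM2l (sqr_ge0 b) gap) _.
by rewrite lerDr.
Qed.

End ladder.

(** * Representation of functionals in L^2 *)

Section completeness.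
Context (R : realType).

(** The telescoping series converges absolutely, since [|d| <= 2^n d^2 + 2^-n] for each increment
    [d], by completing the square. *)
Lemma cvg_of_weighted_square_sum (u : R^nat) :
  (\sum_(0 <= n <oo) (2 ^+ n * (u n.+1 - u n) ^+ 2)%:E < +oo)%E -> cvgn u.
Proof.
set F := (X in (X < _)%E) => Foo.
have a0 n : 0 <= 2 ^+ n * (u n.+1 - u n) ^+ 2.
  by rewrite mulr_ge0 ?sqr_ge0 ?exprn_ge0.
have F0 : (0 <= F)%E by apply: nneseries_ge0 => n _ _; rewrite lee_fin.
have Ffin : F \is a fin_num by rewrite ge0_fin_numE.
have cv : cvgn (series (telescope u)).
  apply: normed_cvg.
  apply: nondecreasing_is_cvgn.
    apply/nondecreasing_seqP. move=> n.
    by rewrite /= seriesSr /= lerDl normr_ge0.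
  exists (fine F + 1 / (1 - 2^-1)) => _ [n _ <-] /=.
  have S2 := @geometric_le_lim R n 1 2^-1 ler01.
  have {}S2 : series (geometric 1 (2^-1)) n <= 1 / (1 - 2^-1) :> R.
    by apply: S2; [|rewrite ger0_norm]; lra.
  have S1 : \sum_(0 <= i < n) (2 ^+ i * (u i.+1 - u i) ^+ 2) <= fine F.
    rewrite -lee_fin fineK // -sumEFin.
    by apply: nneseries_lim_ge => m _ _; rewrite lee_fin.
  apply: le_trans (lerD S1 S2); rewrite /series /= -big_split /=.
  apply: ler_sum => i _; rewrite /telescope /= mul1r.
  set d := u i.+1 - u i; set t := 2 ^+ i.
  have t0 : 0 < t by rewrite /t exprn_gt0.
  rewrite exprVn -/t -[d ^+ 2]real_normK ?num_real//.
  have := sqr_ge0 (t * `|d| - 2^-1) => sq.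
  rewrite -(ler_pM2l t0) mulrDr mulfV ?gt_eqF//.
  rewrite expr2 in sq *; have := normr_ge0 d; nra.
have -> : u = (fun n => u 0%N + series (telescope u) n).
  by apply/funext => n; rewrite -eq_sum_telescope.
by apply: is_cvgD => //; exact: is_cvg_cst.
Qed.

Lemma limn_einf_le (u : (\bar R)^nat) K : (forall n, u n <= K)%E ->
  (limn_einf u <= K)%E.
Proof.
move=> uK; rewrite limn_einf_lim; apply: lime_le.
  exact: is_cvg_einfs.
apply: nearW => n; apply: le_trans (uK n).
by apply: ereal_inf_lbound; exists n => /=.
Qed.

Context d (T : measurableType d) (mu : {measure set T -> \bar R}).

(* The hypothesis is that of a Cauchy sequence with a geometric rate, so that
   no subsequence has to be extracted. *)
Lemma L2_complete (g : nat -> T -> R) (C : R) :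
  (forall n, measurable_fun setT (g n)) ->
  (forall n m, (n <= m)%N ->
    (\int[mu]_x ((g m x - g n x) ^+ 2)%:E <= (C / 4 ^+ n)%:E)%E) ->
  exists2 h : T -> R, measurable_fun setT h &
    forall n, (\int[mu]_x ((h x - g n x) ^+ 2)%:E <= (C / 4 ^+ n)%:E)%E.
Proof.
(* The weight [2^n] is still beaten by the rate [4^-n], so the weighted sum of squared increments is
   integrable, hence finite almost everywhere, and [g n x] converges there. *)
move=> mg gC.
pose a n x := (2 ^+ n * (g n.+1 x - g n x) ^+ 2)%:E.
have a0 n x : (0 <= a n x)%E by rewrite lee_fin mulr_ge0 ?sqr_ge0 ?exprn_ge0.
have msq (f1 f2 : T -> R) : measurable_fun setT f1 -> measurable_fun setT f2 ->
    measurable_fun setT (fun x => ((f1 x - f2 x) ^+ 2)%:E).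
  move=> m1 m2; apply/measurable_EFinP; apply: measurable_funX.
  exact: measurable_funB.
have ma n : measurable_fun setT (a n).
  apply/measurable_EFinP; apply: measurable_funM; first exact: measurable_cst.
  by apply/measurable_EFinP; exact: msq.
pose F x := (\sum_(0 <= n <oo) a n x)%E.
have F0 x : (0 <= F x)%E by apply: nneseries_ge0 => n _ _; exact: a0.
have mF : measurable_fun setT F.
  by apply: ge0_emeasurable_sum.
have intF : mu.-integrable setT F.
  apply/integrableP; split => //.
  under eq_integral do rewrite gee0_abs//.
  rewrite /F integral_nneseries//.
  apply: (@le_lt_trans _ _ (C * 2)%:E); last by rewrite ltry.
  apply: lime_le; first by apply: is_cvg_nneseries => n _ _; exact: integral_ge0.
  apply: nearW => N.
  apply: (@le_trans _ _ (\sum_(0 <= n < N) (C * 2^-1 ^+ n)%:E)%E).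
    apply: lee_sum => n _.
    rewrite /a; under eq_integral do rewrite EFinM.
    rewrite ge0_integralZl//; last 2 first.
    - exact: msq.
    - by move=> x _; rewrite lee_fin sqr_ge0.
    apply: (le_trans (lee_wpmul2l _ (gC n n.+1 (leqnSn n)))).
      by rewrite lee_fin exprn_ge0.
    rewrite -EFinM lee_fin.
    have -> : 4 = 2 * 2 :> R by rewrite -natrM.
    rewrite exprMn exprVn.
    have : 2 ^+ n != 0 :> R by rewrite expf_neq0.
    move: (2 ^+ n) => t.
    by move=> t0; rewrite le_eqVlt; apply/orP; left; apply/eqP; field.
  rewrite sumEFin lee_fin.
  have C0 : 0 <= C.
    have := gC 0%N 0%N (leqnn _); rewrite expr0 divr1 -lee_fin.
    by apply: le_trans; apply: integral_ge0 => x _; rewrite lee_fin sqr_ge0.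
  have := @geometric_le_lim R N C 2^-1 C0 _ _.
  have -> : C * 2 = C / (1 - 2^-1) by field.
  by apply; [|rewrite ger0_norm]; lra.
(* The upper limit is measurable on the whole space and agrees with the limit wherever that exists;
   [fine] sends infinite values to 0. *)
pose h x := fine (limn_esup (fun n => (g n x)%:E)).
have mh : measurable_fun setT h.
  apply: measurableT_comp => //.
  apply: measurable_fun_limn_esup => n.
  exact/measurable_EFinP.
have gh : \forall x \ae mu, g ^~ x @ \oo --> h x.
  have := integrable_ae measurableT intF; apply: filterS => x /(_ I).
  rewrite ge0_fin_numE// => /cvg_of_weighted_square_sum cv.
  have cvE : EFin \o g^~ x @ \oo --> (limn (g^~ x))%:E.
    by apply: cvg_EFin; [exact: nearW|exact: cv].
  rewrite /h; have [_ ->] := cvg_limn_einf_sup cvE.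
  exact: cv.
exists h => // n.
(* The bound on [h - g n] is Fatou's lemma for this sequence; the shift by [n] puts every index in
   the range of the Cauchy hypothesis. *)
pose b m x := ((g (m + n)%N x - g n x) ^+ 2)%:E.
have mb m : measurable_fun setT (b m) by exact: msq.
have -> : (\int[mu]_x ((h x - g n x) ^+ 2)%:E =
           \int[mu]_x limn_einf (b ^~ x))%E.
  apply: ge0_ae_eq_integral => //.
  - exact: msq.
  - rewrite (_ : (fun x => _) = (fun x => - limn_esup (fun m => - b m x))%E).
      apply: measurableT_comp => //; apply: measurable_fun_limn_esup => m.
      exact: measurableT_comp.
    apply/funext => x; by rewrite [X in limn_esup X](_ : _ = -%E \o (b ^~ x))//
      limn_esupN oppeK.
  - by move=> x _; rewrite lee_fin sqr_ge0.
  - move=> x _; rewrite limn_einf_lim; apply: lime_ge; first exact: is_cvg_einfs.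
    apply: nearW => m; apply/ereal_infP => _ [k _ <-].
    by rewrite lee_fin sqr_ge0.
  - apply: filterS gh => x gx _; symmetry.
    suff : b ^~ x @ \oo --> ((h x - g n x) ^+ 2)%:E.
      by move=> /cvg_limn_einf_sup[].
    apply: cvg_EFin; first exact: nearW.
    rewrite (_ : _ \o _ = (fun m => (g (m + n)%N x - g n x) ^+ 2))//.
    rewrite expr2; under eq_cvg do rewrite expr2.
    by apply: cvgM; apply: cvgB; try exact: cvg_cst; rewrite (cvg_shiftn n (g^~ x)).
apply: (le_trans (fatou mu measurableT mb _)).
  by move=> m x _; rewrite lee_fin sqr_ge0.
by apply: limn_einf_le => m; apply: gC; exact: leq_addl.
Qed.

End completeness.

Lemma discriminant_le (R : realFieldType) (a b c : R) : 0 <= c ->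
  (forall t, 0 <= a + 2 * t * b + t ^+ 2 * c) -> b ^+ 2 <= a * c.
Proof.
rewrite le_eqVlt => /predU1P[<-|c0] H.
  have [->|b0] := eqVneq b 0; first by rewrite expr2 !mulr0.
  (* At this [t] the affine function [a + 2 t b] equals [-1]. *)
  have := H (- (a + 1) / (2 * b)); rewrite mulr0 addr0.
  have -> : 2 * (- (a + 1) / (2 * b)) * b = - (a + 1) by field.
  by lra.
have := H (- b / c).
have -> : a + 2 * (- b / c) * b + (- b / c) ^+ 2 * c = (a * c - b ^+ 2) / c.
  by field; rewrite gt_eqF.
by rewrite pmulr_lge0 ?invr_gt0// subr_ge0.
Qed.

Section minimizing_sequence.
Context (R : realType) (V : lmodType R) (q : V -> V -> R) (l : V -> R) (M : R).
Hypothesis qC : forall x y, q x y = q y x.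
Hypothesis qDl : forall x y z, q (x + y) z = q x z + q y z.
Hypothesis qZl : forall t x y, q (t *: x) y = t * q x y.
Hypothesis q_ge0 : forall x, 0 <= q x x.
Hypothesis lD : forall x y, l (x + y) = l x + l y.
Hypothesis lZ : forall t x, l (t *: x) = t * l x.
Hypothesis M0 : 0 <= M.
Hypothesis lM : forall x, l x ^+ 2 <= M * q x x.

Let qDr x y z : q x (y + z) = q x y + q x z.
Proof. by rewrite qC qDl qC (qC z). Qed.

Let qZr t x y : q x (t *: y) = t * q x y.
Proof. by rewrite qC qZl qC. Qed.

(* Minimize [q x x - 2 l x]: the Euler-Lagrange equation is [q x w = l w], and
   the parallelogram identity makes minimizing sequences Cauchy. *)
Lemma minimizing_sequence : exists v : nat -> V,
  (forall n m, (n <= m)%N -> q (v m - v n) (v m - v n) <= 4 / 4 ^+ n) /\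
  (forall n w, (q (v n) w - l w) ^+ 2 <= 4 ^- n * q w w).
Proof.
pose J x := q x x - 2 * l x.
(* Arithmetic-geometric mean: [b^2 <= M a <= ((M + a) / 2)^2], so [2 b <= M + a]. *)
have Jge x : - M <= J x.
  rewrite /J; have := q_ge0 x; have := lM x; set a := q x x; set b := l x.
  move=> ab a0; suff : b <= (M + a) / 2 by lra.
  have Ma : 0 <= (M + a) / 2 by rewrite divr_ge0 ?addr_ge0.
  rewrite leNgt; apply/negP => ltb.
  have : ((M + a) / 2) ^+ 2 < b ^+ 2 by rewrite ltr_pXn2r// nnegrE (le_trans Ma)// ltW.
  apply/negP; rewrite -leNgt (le_trans ab)//.
  have -> : ((M + a) / 2) ^+ 2 = M * a + ((M - a) / 2) ^+ 2 by field.
  by rewrite lerDl sqr_ge0.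
have Jinf : has_inf (range J).
  by split; [exists (J 0), 0|exists (- M) => _ [x _ <-]].
pose m := inf (range J).
have mJ x : m <= J x by apply: ge_inf; [exact: Jinf.2|exists x].
have e0 n : 0 < 4 ^- n :> R by rewrite invr_gt0 exprn_gt0.
have [v vJ] : {v : nat -> V & forall n, J (v n) < m + 4 ^- n}.
  apply: (@choice _ _ (fun n x => J x < m + 4 ^- n)) => n.
  have [_ [x _ <-] xm] := inf_adherent (e0 n) Jinf.
  by exists x.
exists v; split => [n k nk|n w].
  (* The parallelogram identity reads [q (v k - v n) = 2 J (v k) + 2 J (v n) - 4 J (midpoint)], at
     most [2 (4^-k + 4^-n)]. *)
  have := mJ (2^-1 *: (v k + v n)); have := vJ n; have := vJ k.
  have -> : 4 / 4 ^+ n = 4 * 4 ^- n :> R by [].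
  have : 4 ^- k <= 4 ^- n :> R.
    by rewrite lef_pV2 ?posrE ?exprn_gt0// ler_weXn2l//; lra.
  move: (4 ^- k) (4 ^- n) => ek en; rewrite -scaleN1r /J.
  rewrite !(qDl, qDr, qZl, qZr, lD, lZ) (qC (v k) (v n)); lra.
(* Near-minimality of [v n] along the line [v n + t w] makes
   [4^-n + 2 t (q (v n) w - l w) + t^2 q w w] nonnegative for all [t]. *)
rewrite mulrC [X in _ <= X]mulrC; apply: discriminant_le => // t.
have := mJ (v n + t *: w); have := vJ n.
rewrite /J !(qDl, qDr, qZl, qZr, lD, lZ) (qC w (v n)) expr2; lra.
Qed.

End minimizing_sequence.

(** * Square-integrable real functions and their scalar product *)

Section L2.
Context (R : realType) d (T : measurableType d) (mu : {measure set T -> \bar R}).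

Definition L2fun (f : T -> R) : Prop :=
  measurable_fun setT f /\ (\int[mu]_x (f x ^+ 2)%:E < +oo)%E.

Definition dot (f g : T -> R) : R := \int[mu]_x (f x * g x).

Lemma L2fun_integrable_sqr f : L2fun f -> mu.-integrable setT (EFin \o (fun x => f x ^+ 2)).
Proof.
move=> [mf fi]; apply/integrableP; split.
  by apply/measurable_EFinP; exact: measurable_funX.
by under eq_integral do rewrite /= ger0_norm ?sqr_ge0//.
Qed.

Lemma L2fun_integrableM f g : L2fun f -> L2fun g ->
  mu.-integrable setT (EFin \o (fun x => f x * g x)).
Proof.
move=> sf sg.
apply: (@le_integrable _ _ _ _ _ measurableT _
  (EFin \o (fun x => f x ^+ 2 + g x ^+ 2))).
- by apply/measurable_EFinP; apply: measurable_funM; [exact: sf.1|exact: sg.1].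
- move=> x _ /=; rewrite lee_fin normrM [leRHS]ger0_norm; last first.
    by rewrite addr_ge0 ?sqr_ge0.
  rewrite -[f x ^+ 2]real_normK ?num_real// -[g x ^+ 2]real_normK ?num_real//.
  by have := sqr_ge0 (`|f x| - `|g x|); have := normr_ge0 (f x);
    have := normr_ge0 (g x); rewrite !expr2; nra.
- have := integrableD measurableT (L2fun_integrable_sqr sf) (L2fun_integrable_sqr sg).
  by apply: eq_integrable => // x _ /=; rewrite EFinD.
Qed.

Lemma L2funP (f : T -> R) : measurable_fun setT f ->
  mu.-integrable setT (EFin \o (fun x => f x ^+ 2)) -> L2fun f.
Proof.
move=> mf /integrableP[_ fi]; split => //.
by move: fi; under eq_integral do rewrite /= ger0_norm ?sqr_ge0//.
Qed.

Lemma L2funZ t f : L2fun f -> L2fun (fun x => t * f x).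
Proof.
move=> sf; apply: L2funP; first by apply: measurable_funM => //; exact: sf.1.
have := integrableZl measurableT (t ^+ 2) (L2fun_integrable_sqr sf).
by apply: eq_integrable => // x _ /=; rewrite -EFinM exprMn.
Qed.

Lemma L2funD f g : L2fun f -> L2fun g -> L2fun (fun x => f x + g x).
Proof.
move=> sf sg; apply: L2funP.
  by apply: measurable_funD; [exact: sf.1|exact: sg.1].
have s1 := L2fun_integrable_sqr sf; have s2 := L2fun_integrable_sqr sg.
have s3 := L2fun_integrableM (L2funZ 2 sf) sg.
have := integrableD measurableT s1 (integrableD measurableT s3 s2).
by apply: eq_integrable => // x _ /=; rewrite -!EFinD; congr EFin; ring.
Qed.

Lemma L2funB f g : L2fun f -> L2fun g -> L2fun (fun x => f x - g x).
Proof.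
move=> sf sg; have := L2funD sf (L2funZ (-1) sg).
by under [X in L2fun X -> _]eq_fun do rewrite mulN1r.
Qed.

Lemma dotC f g : dot f g = dot g f.
Proof. by apply: eq_Rintegral => x _; rewrite mulrC. Qed.

Lemma dotDl f g h : L2fun f -> L2fun g -> L2fun h ->
  dot (fun x => f x + g x) h = dot f h + dot g h.
Proof.
move=> sf sg sh; rewrite /dot -RintegralD//; try exact: L2fun_integrableM.
by apply: eq_Rintegral => x _; rewrite mulrDl.
Qed.

Lemma dotZl t f h : L2fun f -> L2fun h -> dot (fun x => t * f x) h = t * dot f h.
Proof.
move=> sf sh; rewrite /dot -RintegralZl//; try exact: L2fun_integrableM.
by apply: eq_Rintegral => x _; rewrite mulrA.
Qed.

Lemma dotBl f g h : L2fun f -> L2fun g -> L2fun h ->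
  dot (fun x => f x - g x) h = dot f h - dot g h.
Proof.
move=> sf sg sh; rewrite -[- dot g h]mulN1r -dotZl// -dotDl//; last exact: L2funZ.
by congr (dot _ h); apply/funext => x; rewrite mulN1r.
Qed.

Lemma dot_ge0 f : 0 <= dot f f.
Proof. by apply: Rintegral_ge0 => x _; rewrite -expr2 sqr_ge0. Qed.

Lemma EFin_dot f : L2fun f -> (dot f f)%:E = (\int[mu]_x (f x ^+ 2)%:E)%E.
Proof.
move=> [mf fi]; rewrite /dot /Rintegral.
under eq_integral do rewrite -expr2; rewrite fineK// ge0_fin_numE//.
by apply: integral_ge0 => x _; rewrite lee_fin sqr_ge0.
Qed.

Lemma dot_quadratic_ge0 f g t : L2fun f -> L2fun g ->
  0 <= dot f f + 2 * t * dot f g + t ^+ 2 * dot g g.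
Proof.
move=> sf sg; apply: le_trans (dot_ge0 (fun x => f x + t * g x)) _.
have stg := L2funZ t sg; have s := L2funD sf stg.
rewrite dotDl// dotZl// ![dot _ (fun x => f x + _)]dotC !dotDl// !dotZl//.
by rewrite (dotC g f) expr2; lra.
Qed.

Lemma dot_cauchy_schwarz f g : L2fun f -> L2fun g ->
  dot f g ^+ 2 <= dot f f * dot g g.
Proof.
move=> sf sg; apply: discriminant_le => [|t]; first exact: dot_ge0.
exact: dot_quadratic_ge0.
Qed.

(** The difference is the real part of the integral of [(f1 + i f2) (g1 + i g2)], taken without
    conjugation. The two quadratics are added at [t] and [- t] to produce the sign. *)
Lemma dot_cauchy_schwarz2 f1 f2 g1 g2 :
  L2fun f1 -> L2fun f2 -> L2fun g1 -> L2fun g2 ->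
  (dot f1 g1 - dot f2 g2) ^+ 2 <=
    (dot f1 f1 + dot f2 f2) * (dot g1 g1 + dot g2 g2).
Proof.
move=> sf1 sf2 sg1 sg2; apply: discriminant_le => [|t].
  by rewrite addr_ge0 ?dot_ge0.
have := dot_quadratic_ge0 t sf1 sg1; have := dot_quadratic_ge0 (- t) sf2 sg2.
rewrite sqrrN; lra.
Qed.

Lemma dot_cvg (g_ : nat -> T -> R) g : (forall n, L2fun (g_ n)) -> L2fun g ->
  (fun n => dot (fun x => g x - g_ n x) (fun x => g x - g_ n x)) @ \oo --> 0 ->
  forall f, L2fun f -> (fun n => dot (g_ n) f) @ \oo --> dot g f.
Proof.
move=> sg_ sg cv f sf.
have cv2 : (fun n => (dot g f - dot (g_ n) f) ^+ 2) @ \oo --> 0.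
  apply: (@squeeze_cvgr _ _ _ _ (fun=> 0) (fun n =>
    dot (fun x => g x - g_ n x) (fun x => g x - g_ n x) * dot f f)).
  - apply: nearW => n; rewrite sqr_ge0/= -dotBl//.
    by apply: dot_cauchy_schwarz => //; exact: L2funB.
  - exact: cvg_cst.
  - by rewrite -[X in _ --> X](mul0r (dot f f)); apply: cvgM => //; exact: cvg_cst.
have : (fun n => dot g f - dot (g_ n) f) @ \oo --> 0.
  apply/cvgr0Pnorm_lt => e e0.
  move/cvgr0Pnorm_lt : cv2 => /(_ _ (exprn_gt0 2 e0)); apply: filterS => n.
  by rewrite normrX ltr_pXn2r// nnegrE ltW.
move=> c0; rewrite -[X in _ --> X]subr0.
rewrite (_ : (fun n => dot (g_ n) f) =
  (fun n => dot g f - (dot g f - dot (g_ n) f))); last first.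
  by apply/funext => n; rewrite subKr.
by apply: cvgB => //; exact: cvg_cst.
Qed.

End L2.

(** * Riesz representation for a seminorm pulled back from two copies of L^2 *)

Section riesz.
Context (R : realType) d (T : measurableType d) (mu : {measure set T -> \bar R}).
Context (V : lmodType R) (A B : V -> T -> R) (l : V -> R) (M : R).
Local Notation dot := (dot mu).
Hypothesis sA : forall v, L2fun mu (A v).
Hypothesis sB : forall v, L2fun mu (B v).
Hypothesis AD : forall v w, A (v + w) = (fun x => A v x + A w x).
Hypothesis BD : forall v w, B (v + w) = (fun x => B v x + B w x).
Hypothesis AZ : forall t v, A (t *: v) = (fun x => t * A v x).
Hypothesis BZ : forall t v, B (t *: v) = (fun x => t * B v x).
Hypothesis lD : forall x y, l (x + y) = l x + l y.
Hypothesis lZ : forall t x, l (t *: x) = t * l x.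
Hypothesis M0 : 0 <= M.
Hypothesis lM :
  forall v, l v ^+ 2 <= M * (dot (A v) (A v) + dot (B v) (B v)).

(** No completion of [V] is formed: along a minimizing sequence [v n], the images [A (v n)] and
    [B (v n)] are Cauchy in L^2, and their limits [g] and [h] represent [l]. *)
Lemma L2_riesz : exists g h : T -> R,
  [/\ L2fun mu g, L2fun mu h, dot g g + dot h h <= M &
      forall v, dot g (A v) + dot h (B v) = l v].
Proof.
pose q v w := dot (A v) (A w) + dot (B v) (B w).
have qC v w : q v w = q w v by congr (_ + _); exact: dotC.
have [|||v [vC vE]] := @minimizing_sequence R V q l M qC _ _ _ lD lZ M0 lM.
- by move=> x y z; rewrite /q AD BD !dotDl//; lra.
- by move=> t x y; rewrite /q AZ BZ !dotZl//; lra.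
- by move=> x; rewrite addr_ge0 ?dot_ge0.
have lim2 (F : V -> T -> R) : (forall v, L2fun mu (F v)) ->
    (forall v w, F (v - w) = (fun x => F v x - F w x)) ->
    (forall w, dot (F w) (F w) <= q w w) ->
  exists2 g, L2fun mu g &
    (fun n => dot (fun x => g x - F (v n) x) (fun x => g x - F (v n) x)) @ \oo --> 0.
  move=> sF FB Fq.
  have [n|n m nm|g mg gF] := @L2_complete R _ T mu (fun n => F (v n)) 4.
  - exact: (sF _).1.
  - have := EFin_dot (sF (v m - v n)); rewrite FB => <-.
    by rewrite lee_fin -FB (le_trans (Fq _))// vC.
  have sgF n : L2fun mu (fun x => g x - F (v n) x).
    split; last by apply: le_lt_trans (gF n) _; rewrite ltry.
    by apply: measurable_funB => //; exact: (sF _).1.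
  exists g.
    have := L2funD (sgF 0%N) (sF (v 0%N)).
    by under [X in L2fun _ X -> _]eq_fun do rewrite subrK.
  apply: (@squeeze_cvgr _ _ _ _ (fun=> 0) (fun n => geometric 4 4^-1 n)).
  - apply: nearW => n; rewrite dot_ge0/= exprVn -lee_fin EFin_dot//.
  - exact: cvg_cst.
  - by apply: cvg_geometric; rewrite ger0_norm; lra.
have [|w|g sg cg] := lim2 A sA.
- by move=> x y; rewrite -scaleN1r AD AZ; apply/funext => z; rewrite mulN1r.
- by rewrite lerDl dot_ge0.
have [|w|h sh ch] := lim2 B sB.
- by move=> x y; rewrite -scaleN1r BD BZ; apply/funext => z; rewrite mulN1r.
- by rewrite lerDr dot_ge0.
exists g, h.
have gA := dot_cvg (fun n => sA (v n)) sg cg.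
have hB := dot_cvg (fun n => sB (v n)) sh ch.
have El w : dot g (A w) + dot h (B w) = l w.
  have c1 : (fun n => q (v n) w) @ \oo --> dot g (A w) + dot h (B w).
    by apply: cvgD; [exact: gA|exact: hB].
  have c2 : (fun n => q (v n) w) @ \oo --> l w.
    have : (fun n => q (v n) w - l w) @ \oo --> 0.
      apply/cvgr0Pnorm_lt => e e0.
      have c4 : (fun n => geometric (q w w) 4^-1 n) @ \oo --> 0.
        by apply: cvg_geometric; rewrite ger0_norm; lra.
      move/cvgr0Pnorm_lt : c4 => /(_ _ (exprn_gt0 2 e0)).
      apply: filterS => n /= lt.
      have := le_lt_trans (ler_norm _) lt; rewrite exprVn mulrC.
      move=> /(le_lt_trans (vE n w)) lte.
      have : `|q (v n) w - l w| ^+ 2 < e ^+ 2 by rewrite real_normK ?num_real.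
      by rewrite ltr_pXn2r// nnegrE ltW.
    move=> c0; rewrite -[X in _ --> X]add0r.
    rewrite (_ : (fun n => q (v n) w) = (fun n => (q (v n) w - l w) + l w)).
      by apply: cvgD => //; exact: cvg_cst.
    by apply/funext => n; rewrite subrK.
  by rewrite -(cvg_lim (@Rhausdorff R) c1) -(cvg_lim (@Rhausdorff R) c2).
split => //.
set P := dot g g + dot h h.
have cl : (fun n => l (v n)) @ \oo --> P.
  under eq_fun do rewrite -El ![dot _ (_ (v _))]dotC.
  by apply: cvgD; [exact: gA|exact: hB].
(* Expanding the squared distances from [g] and [h] gives [q (v n) (v n)] as these distances, which
   tend to 0, plus [2 l (v n) - P]. With [l (v n)] also tending to [P], the bound on [l] becomes
   [P^2 <= M P]. *)
have cN : (fun n => q (v n) (v n)) @ \oo --> P.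
  rewrite [X in _ --> X](_ : P = 0 + 0 + (P + P - P)); last by lra.
  rewrite (_ : (fun n => _) = (fun n =>
    dot (fun x => g x - A (v n) x) (fun x => g x - A (v n) x) +
    dot (fun x => h x - B (v n) x) (fun x => h x - B (v n) x) +
    (l (v n) + l (v n) - P))).
    apply: cvgD; first exact: cvgD.
    by apply: cvgB; [exact: cvgD|exact: cvg_cst].
  apply/funext => n.
  have BR (f1 f2 : T -> R) : L2fun mu f1 -> L2fun mu f2 ->
     dot (fun x => f1 x - f2 x) (fun x => f1 x - f2 x) =
     dot f1 f1 - 2 * dot f1 f2 + dot f2 f2.
    move=> s1 s2; have s := L2funB s1 s2.
    by rewrite dotBl// ![dot _ (fun x => _ - _)]dotC !dotBl// (dotC _ f2); lra.
  by rewrite !BR// -El /P /q; lra.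
have : P ^+ 2 <= M * P.
  have c1 : (fun n => M * q (v n) (v n)) @ \oo --> M * P.
    by apply: cvgM => //; exact: cvg_cst.
  have c2 : (fun n => l (v n) * l (v n)) @ \oo --> P * P by exact: cvgM.
  rewrite expr2; apply: (@ler_cvg_to _ _ _ _ _ _ _ _ c2 c1).
  by apply: nearW => n; rewrite -expr2.
have := dot_ge0 mu g; have := dot_ge0 mu h; rewrite -/P => h0 g0.
have [<-//|P0] := eqVneq 0 P.
rewrite expr2 ler_pM2r//.
by rewrite lt_neqAle P0/= addr_ge0.
Qed.

End riesz.

(** * Calculus on the plane *)

Section plane_measure.
Context (R : realType).
Implicit Types (U : set (R * R)) (f : R * R -> R).

Lemma open_measurable_plane U : open U -> measurable (U : set (plane R)).
Proof.
move=> oU.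
pose box (i : rat * rat * rat) : set (plane R) :=
  `]ratr i.1.1 - ratr i.2, ratr i.1.1 + ratr i.2[%classic `*`
  `]ratr i.1.2 - ratr i.2, ratr i.1.2 + ratr i.2[%classic.
pose F i := if `[< box i `<=` (U : set (plane R)) >] then box i else set0.
have -> : (U : set (plane R)) = \bigcup_i F i.
  apply/seteqP; split => [[x y] Uxy|p [i _]]; last first.
    by rewrite /F; case: ifPn => // /asboolP; exact.
  have /nbhs_ballP[e /= e0 eU] := open_nbhs_nbhs (conj oU Uxy).
  (* The rational centre lies within [r] of the point in each coordinate, so the box of half-width
     [r] stays within [2 r < e] of it. *)
  have [r /itvP r_] : exists r : rat, ratr r \in `]0, (e / 2)[.
    by apply: rat_in_itvoo; rewrite divr_gt0.
  have r0 : 0 < ratr r :> R by rewrite r_.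
  have [a /itvP a_] : exists a : rat, ratr a \in `]x - ratr r, x + ratr r[.
    by apply: rat_in_itvoo; lra.
  have [b /itvP b_] : exists b : rat, ratr b \in `]y - ratr r, y + ratr r[.
    by apply: rat_in_itvoo; lra.
  have re : ratr r < e / 2 by rewrite r_.
  have [a1 a2 b1 b2] : [/\ x - ratr r < ratr a, ratr a < x + ratr r,
      y - ratr r < ratr b & ratr b < y + ratr r] by rewrite !a_ !b_.
  exists (a, b, r) => //; rewrite /F ifT; last first.
    apply/asboolP => -[u v] [/=]; rewrite !in_itv/= => /andP[u1 u2] /andP[v1 v2].
    by apply: eU; split => /=; rewrite -ball_normE/= ltr_norml; apply/andP; split; lra.
  by split => /=; rewrite in_itv/=; apply/andP; split; lra.
apply: countable_bigcupT_measurable => [|i]; first exact: countableP.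
by rewrite /F; case: ifP => // _; apply: measurableX.
Qed.

Lemma closed_measurable_plane U : closed U -> measurable (U : set (plane R)).
Proof.
move=> cU; rewrite -[U]setCK; apply: measurableC; apply: open_measurable_plane.
exact: closed_openC.
Qed.

Lemma compact_measurable_plane U : compact U -> measurable (U : set (plane R)).
Proof.
by move=> cU; apply: closed_measurable_plane; exact: compact_closed.
Qed.

Lemma continuous_measurable_plane f : continuous f ->
  measurable_fun [set: plane R] (f : plane R -> measurableTypeR R).
Proof.
move=> /continuousP cf; apply: (measurability _ (RGenOpens.measurableE R)).
move=> _ [_ [a [b ->] <-]]; rewrite setTI; apply: open_measurable_plane.
exact/cf/interval_open.
Qed.

(** The norm of [R * R] is the maximum norm, so the support lies in a product of segments, which
    suits Fubini and one-variable slices. *)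
Definition box_supported (r : R) f := forall z, r < `|z| -> f z = 0.

Let cube (r : R) : set (plane R) := `[- r, r]%classic `*` `[- r, r]%classic.

Let cubeP (r : R) (z : R * R) : cube r z <-> `|z| <= r.
Proof.
case: z => x y; rewrite /cube /= !in_itv/= -!ler_norml.
by rewrite prod_normE/= ge_max; split => [[-> ->]|/andP[-> ->]].
Qed.

Lemma continuous_bounded_cube f (r : R) : continuous f ->
  exists M, forall z, `|z| <= r -> `|f z| <= M.
Proof.
move=> cf.
have cptX : compact (cube r : set (R * R)).
  by apply: compact_setX; exact: segment_compact.
have /compact_bounded [M [_ Mf]] : compact (f @` (cube r)).
  by apply: continuous_compact => //; exact: continuous_subspaceT.
exists (`|M| + 1) => z /cubeP zr; apply: Mf; last by exists z.
by rewrite (le_lt_trans (ler_norm _))// ltrDl.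
Qed.

Lemma continuous_box_integrable f r : continuous f -> box_supported r f ->
  (dsigma R).-integrable [set: plane R] (EFin \o (f : plane R -> R)).
Proof.
move=> cf fr; have [M Mf] := continuous_bounded_cube r cf.
have mcube : measurable (cube r) by exact: measurableX.
have -> : EFin \o (f : plane R -> R) = (EFin \o f) \_ (cube r).
  apply/funext => z; rewrite patchE; case: ifPn => // /negP zr /=.
  rewrite fr// ltNge; apply/negP => /cubeP zr'; apply: zr; exact: mem_set.
apply/(integrable_mkcond _ mcube); apply: measurable_bounded_integrable => //.
- pose I : set R := `[- r, r]%classic.
  have fin : (lebesgue_measure I < +oo)%E.
    by rewrite /I lebesgue_measure_itv/=; case: ifP; rewrite -?EFinB ltry.
  by rewrite /dsigma/= product_measure1E// lte_mul_pinfty// ge0_fin_numE.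
- by apply: measurable_funTS; exact: continuous_measurable_plane.
- exists M; split; first by rewrite num_real.
  by move=> K MK z /cubeP zr; apply: le_trans (ltW MK); exact: Mf.
Qed.

End plane_measure.

(** * Partial derivatives: integration along slices and symmetry of mixed derivatives *)

Section partial_derivatives.
Context (R : realType).
Implicit Types (f g p q : R * R -> R) (e : R * R).
Local Notation ex := ((1, 0) : R * R).
Local Notation ey := ((0, 1) : R * R).

Lemma is_derive_slice_x f x y df :
  is_derive ((x, y) : R * R) ex f df <-> is_derive x 1 (fun t => f (t, y)) df.
Proof.
have E : (fun h : R => h^-1 *: ((f \o shift (x, y)) (h *: ex) - f (x, y))) =
    (fun h : R => h^-1 *: (((fun t => f (t, y)) \o shift x) (h *: 1) - f (x, y))).
  apply/funext => h; congr (_ *: (f _ - _)); rewrite /shift/=.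
by congr pair; rewrite -[LHS]/(h * 0 + y) mulr0 add0r.
by split=> -[d1 d2]; split; move: d1 d2; rewrite /derivable /derive E.
Qed.

Lemma is_derive_slice_y f x y df :
  is_derive ((x, y) : R * R) ey f df <-> is_derive y 1 (fun t => f (x, t)) df.
Proof.
have E : (fun h : R => h^-1 *: ((f \o shift (x, y)) (h *: ey) - f (x, y))) =
    (fun h : R => h^-1 *: (((fun t => f (x, t)) \o shift y) (h *: 1) - f (x, y))).
  apply/funext => h; congr (_ *: (f _ - _)); rewrite /shift/=.
  by congr pair; rewrite -[LHS]/(h * 0 + x) mulr0 add0r.
by split=> -[d1 d2]; split; move: d1 d2; rewrite /derivable /derive E.
Qed.

Lemma derivable_is_derive f z e : derivable f z e -> is_derive z e f ('D_e f z).
Proof. by move=> df; split. Qed.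

Lemma slice_x_continuous f y : continuous f -> continuous (fun t => f (t, y)).
Proof.
move=> cf x; apply: (@continuous_comp _ _ _ (fun t : R => (t, y)) f); last exact: cf.
exact: (cvg_pair cvg_id (cvg_cst y)).
Qed.

Lemma slice_y_continuous f x : continuous f -> continuous (fun t => f (x, t)).
Proof.
move=> cf y; apply: (@continuous_comp _ _ _ (fun t : R => (x, t)) f); last exact: cf.
exact: (cvg_pair (cvg_cst x) cvg_id).
Qed.

Lemma integral_deriv_compact (F dF : R -> R) (r : R) : continuous dF ->
  (forall x : R, is_derive x 1 F (dF x)) ->
  (forall x, r < `|x| -> F x = 0) -> (forall x, r < `|x| -> dF x = 0) ->
  (\int[@lebesgue_measure R]_x (dF x)%:E = 0)%E.
Proof.
move=> cdF FdF F0 dF0.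
(* Positive even when [r] is negative, and beyond the support, so both boundary terms vanish. *)
pose s : R := `|r| + 1.
have rs : r < s by rewrite (le_lt_trans (ler_norm _))// ltrDl.
have s0 : 0 < s by rewrite ltr_wpDl.
have Fs : F s = 0 by rewrite F0// gtr0_norm.
have FNs : F (- s) = 0 by rewrite F0// normrN gtr0_norm.
have FT : {within `[- s, s], continuous F}.
  apply: continuous_subspaceT => x; apply: differentiable_continuous.
  by apply/derivable1_diffP; have [] := FdF x.
pose I : set R := `[- s, s]%classic.
have : (\int[@lebesgue_measure R]_(x in I) (dF x)%:E =
    (F s)%:E - (F (- s))%:E)%E.
  apply: continuous_FTC2; first lra.
  - exact: continuous_subspaceT.
  - have /(continuous_within_itvP _ _) := FT; move=> /(_ ltac:(lra)) [_ l r'].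
    by split => // x _; have [] := FdF x.
  - by move=> x _; rewrite derive1E; have [_ ->] := FdF x.
rewrite Fs FNs subee// integral_mkcond => <-; apply: eq_integral => x _.
rewrite patchE; case: ifPn => // /negP xs; congr EFin; apply: dF0.
rewrite (lt_trans rs)// ltNge ler_norml; apply/negP => xs'; apply: xs.
by rewrite mem_set//= in_itv.
Qed.

Lemma box_supported_derive f r e :
  box_supported r f -> box_supported r ('D_e f).
Proof.
move=> fr z rz; rewrite -(derive_cst (0 : R) z e); apply: near_eq_derive.
have : open [set z : R * R | r < `|z|].
  rewrite (_ : [set _ | _] = (fun z : R * R => `|z|) @^-1` [set x | r < x]).
    by apply: open_comp; [move=> *; exact: norm_continuous|exact: open_gt].
  by [].
move=> /(_ z rz); apply: filterS => u; exact: fr.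
Qed.

(** Fubini with the [x]-integral inside, which vanishes by the fundamental theorem of calculus.
    Applied to a weighted product, this is integration by parts. *)
Lemma integral_derive_x f df r : continuous df ->
  (forall z, is_derive z ex f (df z)) -> box_supported r f ->
  \int[dsigma R]_z df z = 0.
Proof.
move=> cdf fdf fr.
have dfE : df = 'D_ex f by apply/funext => z; have [_ ->] := fdf z.
have dfr : box_supported r df by rewrite dfE; exact: box_supported_derive.
rewrite /Rintegral -integral21_prod_meas1; last exact: continuous_box_integrable dfr.
rewrite integral0_eq// => y _.
apply: (@integral_deriv_compact (fun t => f (t, y)) (fun t => df (t, y)) r).
- exact: slice_x_continuous.
- by move=> x; exact/is_derive_slice_x.
- by move=> x rx; apply: fr; rewrite prod_normE/= lt_max rx.
- by move=> x rx; apply: dfr; rewrite prod_normE/= lt_max rx.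
Qed.

Lemma integral_derive_y f df r : continuous df ->
  (forall z, is_derive z ey f (df z)) -> box_supported r f ->
  \int[dsigma R]_z df z = 0.
Proof.
move=> cdf fdf fr.
have dfE : df = 'D_ey f by apply/funext => z; have [_ ->] := fdf z.
have dfr : box_supported r df by rewrite dfE; exact: box_supported_derive.
rewrite /Rintegral -integral12_prod_meas1; last exact: continuous_box_integrable dfr.
rewrite integral0_eq// => x _.
apply: (@integral_deriv_compact (fun t => f (x, t)) (fun t => df (x, t)) r).
- exact: slice_y_continuous.
- by move=> y; exact/is_derive_slice_y.
- by move=> y ry; apply: fr; rewrite prod_normE/= lt_max ry orbT.
- by move=> y ry; apply: dfr; rewrite prod_normE/= lt_max ry orbT.
Qed.

Lemma MVT_everywhere (F dF : R -> R) a h : 0 < h ->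
  (forall x : R, is_derive x 1 F (dF x)) ->
  exists2 c, `|c - a| < h & F (a + h) - F a = dF c * h.
Proof.
move=> h0 FdF; have ah : a < a + h by rewrite ltrDl.
have [|c] := @MVT R F dF a (a + h) ah.
  apply: continuous_subspaceT => x; apply: differentiable_continuous.
  by apply/derivable1_diffP; have [] := FdF x.
rewrite in_itv/= => /andP[ac ca] Fc; exists c; last by rewrite Fc; congr (_ * _); ring.
by rewrite ger0_norm; lra.
Qed.

Lemma le_dist_halves (u v w eps : R) :
  `|u - w| < eps / 2 -> `|v - w| < eps / 2 -> `|u - v| <= eps.
Proof. by move=> uw vw; have := ler_distD w u v; rewrite (distrC w); lra. Qed.

(** Schwarz's theorem. The second difference of [f] over a square of side [h], computed in both
    orders by the mean value theorem, equates the two mixed derivatives at points near [(x, y)];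
    continuity concludes. *)
Lemma derive_exey f :
  (forall z, derivable f z ex) -> (forall z, derivable f z ey) ->
  (forall z, derivable ('D_ex f) z ey) -> (forall z, derivable ('D_ey f) z ex) ->
  continuous ('D_ey ('D_ex f)) -> continuous ('D_ex ('D_ey f)) ->
  'D_ey ('D_ex f) = 'D_ex ('D_ey f).
Proof.
move=> fx fy fxy fyx cxy cyx; apply/funext => -[x y]; apply/eqP.
rewrite -subr_eq0 -normr_le0; apply/ler_addgt0Pr => eps eps0; rewrite add0r.
have e2 : 0 < eps / 2 by rewrite divr_gt0.
have /cvgrPdist_lt/(_ _ e2)/nbhs_ballP[d1 /= d1_0 B1] := cxy (x, y).
have /cvgrPdist_lt/(_ _ e2)/nbhs_ballP[d2 /= d2_0 B2] := cyx (x, y).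
pose h := Num.min d1 d2.
have h0 : 0 < h by rewrite lt_min d1_0.
have [hd1 hd2] : h <= d1 /\ h <= d2 by rewrite !ge_min !lexx orbT.
have [c xc Ec] : exists2 c, `|c - x| < h &
    (f (x + h, y + h) - f (x + h, y)) - (f (x, y + h) - f (x, y)) =
    ('D_ex f (c, y + h) - 'D_ex f (c, y)) * h.
  apply: (@MVT_everywhere (fun t => f (t, y + h) - f (t, y))
    (fun t => 'D_ex f (t, y + h) - 'D_ex f (t, y)) x h); first exact: h0.
  move=> t.
  by apply: is_deriveB; apply/is_derive_slice_x; exact: derivable_is_derive.
have [c' yc' Ec'] : exists2 c', `|c' - y| < h &
    'D_ex f (c, y + h) - 'D_ex f (c, y) = 'D_ey ('D_ex f) (c, c') * h.
  apply: (@MVT_everywhere (fun t => 'D_ex f (c, t))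
    (fun t => 'D_ey ('D_ex f) (c, t)) y h); first exact: h0.
  move=> t; apply: (is_derive_slice_y ('D_ex f) c t _).1.
  exact: derivable_is_derive.
have [k yk Ek] : exists2 k, `|k - y| < h &
    (f (x + h, y + h) - f (x, y + h)) - (f (x + h, y) - f (x, y)) =
    ('D_ey f (x + h, k) - 'D_ey f (x, k)) * h.
  apply: (@MVT_everywhere (fun t => f (x + h, t) - f (x, t))
    (fun t => 'D_ey f (x + h, t) - 'D_ey f (x, t)) y h); first exact: h0.
  move=> t.
  by apply: is_deriveB; apply/is_derive_slice_y; exact: derivable_is_derive.
have [k' xk' Ek'] : exists2 k', `|k' - x| < h &
    'D_ey f (x + h, k) - 'D_ey f (x, k) = 'D_ex ('D_ey f) (k', k) * h.
  apply: (@MVT_everywhere (fun t => 'D_ey f (t, k))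
    (fun t => 'D_ex ('D_ey f) (t, k)) x h); first exact: h0.
  move=> t; apply: (is_derive_slice_x ('D_ey f) t k _).1.
  exact: derivable_is_derive.
have same : 'D_ey ('D_ex f) (c, c') = 'D_ex ('D_ey f) (k', k).
  have swap (p1 p2 p3 p4 : R) : p1 - p2 - (p3 - p4) = p1 - p3 - (p2 - p4) by ring.
  have hn : h != 0 by rewrite gt_eqF.
  by move: Ec Ek; rewrite Ec' Ek' swap => -> /(mulIf hn)/(mulIf hn).
have b1 : ball ((x, y) : R * R) d1 (c, c').
  by split; rewrite /= -ball_normE /ball_/= distrC; apply: lt_le_trans hd1.
have b2 : ball ((x, y) : R * R) d2 (k', k).
  by split; rewrite /= -ball_normE /ball_/= distrC; apply: lt_le_trans hd2.
by have := B1 _ b1; rewrite same => uw; exact: le_dist_halves uw (B2 _ b2).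
Qed.

End partial_derivatives.

(** * Test functions *)

Section smooth_functions.
Context (R : realType).
Implicit Types (f g p q : R * R -> R) (e : R * R).
Local Notation ex := ((1, 0) : R * R).
Local Notation ey := ((0, 1) : R * R).

Lemma of_class_C_continuous n f : of_class_C n f -> continuous f.
Proof. by case: n => [|n] // []. Qed.

Lemma of_class_CW n f : of_class_C n.+1 f -> of_class_C n f.
Proof.
elim: n f => [|n IH] f.
  by case.
case=> cf fx fy cx cy.
exact (And5 cf fx fy (IH _ cx) (IH _ cy)).
Qed.

Lemma of_class_CD n f g : of_class_C n f -> of_class_C n g ->
  of_class_C n (fun z => f z + g z).
Proof.
elim: n f g => [|n IH] f g.
  by move=> cf cg z; apply: cvgD; [exact: cf|exact: cg].
move=> [cf fx fy cfx cfy] [cg gx gy cgx cgy].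
have De e : (forall z, derivable f z e) -> (forall z, derivable g z e) ->
    'D_e (fun z => f z + g z) = (fun z => 'D_e f z + 'D_e g z).
  by move=> df dg; apply/funext => z; exact: deriveD.
split.
- by move=> z; apply: cvgD; [exact: cf|exact: cg].
- by move=> z; exact: derivableD.
- by move=> z; exact: derivableD.
- by rewrite (De _ fx gx); apply: (IH _ _ cfx cgx).
- by rewrite (De _ fy gy); apply: (IH _ _ cfy cgy).
Qed.

Lemma of_class_C_cst n (c : R) : of_class_C n (fun=> c).
Proof.
elim: n c => [|n IH] c; first exact: cst_continuous.
have De e : 'D_e (fun _ : R * R => c) = (fun=> 0).
  by apply/funext => z; exact: derive_cst.
split; first exact: cst_continuous.
- by move=> z; exact: derivable_cst.
- by move=> z; exact: derivable_cst.
- by rewrite De; apply: IH.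
- by rewrite De; apply: IH.
Qed.

Lemma is_derive_fst_x (z : R * R) : is_derive z ex (fst : R * R -> R) 1.
Proof. by case: z => x y; apply/is_derive_slice_x; exact: is_derive_id. Qed.

Lemma is_derive_fst_y (z : R * R) : is_derive z ey (fst : R * R -> R) 0.
Proof. by case: z => x y; apply/is_derive_slice_y; exact: is_derive_cst. Qed.

Lemma is_derive_snd_x (z : R * R) : is_derive z ex (snd : R * R -> R) 0.
Proof. by case: z => x y; apply/is_derive_slice_x; exact: is_derive_cst. Qed.

Lemma is_derive_snd_y (z : R * R) : is_derive z ey (snd : R * R -> R) 1.
Proof. by case: z => x y; apply/is_derive_slice_y; exact: is_derive_id. Qed.

Lemma is_deriveM_fun (V : normedModType R) (f g : V -> R) (z e : V) (df dg : R) :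
  is_derive z e f df -> is_derive z e g dg ->
  is_derive z e (fun u => f u * g u) (f z * dg + g z * df).
Proof. by move=> df' dg'; exact: (is_deriveM df' dg'). Qed.

Lemma of_class_CM n f g : of_class_C n f -> of_class_C n g ->
  of_class_C n (fun z => f z * g z).
Proof.
elim: n f g => [|n IH] f g.
  by move=> cf cg z; apply: cvgM; [exact: cf|exact: cg].
(* The product rule multiplies a derivative by an undifferentiated factor, which must therefore be
   lowered to class [n]. *)
move=> Cf Cg; have [wf wg] := (of_class_CW Cf, of_class_CW Cg).
move: Cf Cg => [cf fx fy cfx cfy] [cg gx gy cgx cgy].
have De e : (forall z, derivable f z e) -> (forall z, derivable g z e) ->
    'D_e (fun z => f z * g z) = (fun z => f z * 'D_e g z + g z * 'D_e f z).
  by move=> df dg; apply/funext => z; exact: deriveM.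
split.
- by move=> z; apply: cvgM; [exact: cf|exact: cg].
- by move=> z; exact: derivableM.
- by move=> z; exact: derivableM.
- rewrite (De _ fx gx); apply: of_class_CD; first exact: (IH _ _ wf cgx).
  exact: (IH _ _ wg cfx).
- rewrite (De _ fy gy); apply: of_class_CD; first exact: (IH _ _ wf cgy).
  exact: (IH _ _ wg cfy).
Qed.

Lemma of_class_C_fst n : of_class_C n (fst : R * R -> R).
Proof.
case: n => [|n]; first by move=> z; exact: cvg_fst.
split.
- by move=> z; exact: cvg_fst.
- by move=> z; have [] := is_derive_fst_x z.
- by move=> z; have [] := is_derive_fst_y z.
- rewrite (_ : 'D_ex _ = (fun=> 1 : R)); first exact: of_class_C_cst.
  by apply/funext => z; have [] := is_derive_fst_x z.
- rewrite (_ : 'D_ey _ = (fun=> 0 : R)); first exact: of_class_C_cst.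
  by apply/funext => z; have [] := is_derive_fst_y z.
Qed.

Lemma of_class_C_snd n : of_class_C n (snd : R * R -> R).
Proof.
case: n => [|n]; first by move=> z; exact: cvg_snd.
split.
- by move=> z; exact: cvg_snd.
- by move=> z; have [] := is_derive_snd_x z.
- by move=> z; have [] := is_derive_snd_y z.
- rewrite (_ : 'D_ex _ = (fun=> 0 : R)); first exact: of_class_C_cst.
  by apply/funext => z; have [] := is_derive_snd_x z.
- rewrite (_ : 'D_ey _ = (fun=> 1 : R)); first exact: of_class_C_cst.
  by apply/funext => z; have [] := is_derive_snd_y z.
Qed.

Definition is_test f : Prop :=
  (forall n, of_class_C n f) /\ exists r, box_supported r f.

Lemma is_testD f g : is_test f -> is_test g -> is_test (f + g).
Proof.
move=> [cf [r fr]] [cg [s gs]]; split; first by move=> n; exact: of_class_CD.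
exists (Num.max r s) => z; rewrite gt_max => /andP[rz sz].
by rewrite fctE fr// gs// addr0.
Qed.

Lemma is_testM f g : (forall n, of_class_C n f) -> is_test g ->
  is_test (fun z => f z * g z).
Proof.
move=> cf [cg [s gs]]; split; first by move=> n; exact: of_class_CM.
by exists s => z sz; rewrite gs// mulr0.
Qed.

Lemma is_test_submod_closed : submod_closed (fun f => `[< is_test f >]).
Proof.
split => [|t f g /asboolP tf /asboolP tg]; apply/asboolP.
  by split; [move=> n; exact: of_class_C_cst|exists 0].
by apply: is_testD => //; apply: is_testM => // n; exact: of_class_C_cst.
Qed.

Lemma is_test_Dx f : is_test f -> is_test ('D_ex f).
Proof.
move=> [cf [r fr]]; split; first by move=> n; have [] := cf n.+1.
by exists r; exact: box_supported_derive.
Qed.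

Lemma is_test_Dy f : is_test f -> is_test ('D_ey f).
Proof.
move=> [cf [r fr]]; split; first by move=> n; have [] := cf n.+1.
by exists r; exact: box_supported_derive.
Qed.

End smooth_functions.

(** * Test functions as a real vector space, their operators and Gaussian scalar product *)

Section test_type.
Context (R : realType).

Definition test_pred : {pred (R * R -> R)} := fun f => `[< is_test f >].

HB.instance Definition _ :=
  GRing.isSubmodClosed.Build R (R * R -> R) test_pred (@is_test_submod_closed R).

Record test := Test { test_val :> R * R -> R ; _ : test_val \in test_pred }.

HB.instance Definition _ := [isSub for test_val].
HB.instance Definition _ := [Choice of test by <:].
HB.instance Definition _ := [SubChoice_isSubLmodule of test by <:].
End test_type.

Section test_operators.
Context (R : realType).
Implicit Types (f g : test R).
Local Notation ex := ((1, 0) : R * R).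
Local Notation ey := ((0, 1) : R * R).

Lemma testP f : is_test f.
Proof. by apply/asboolP; case: f. Qed.

Definition mk_test (f : R * R -> R) (tf : is_test f) : test R :=
  @Test R f (introT (asboolP _) tf).

Lemma test_ext f g : (forall z, f z = g z) -> f = g.
Proof. by move=> fg; apply: val_inj; apply/funext. Qed.

Definition test_Dx f := mk_test (is_test_Dx (testP f)).
Definition test_Dy f := mk_test (is_test_Dy (testP f)).
Definition test_Mx f := mk_test (is_testM (@of_class_C_fst R) (testP f)).
Definition test_My f := mk_test (is_testM (@of_class_C_snd R) (testP f)).

Lemma testDE f g z : (f + g : test R) z = f z + g z. Proof. by []. Qed.
Lemma testNE f z : (- f : test R) z = - f z. Proof. by []. Qed.
Lemma testZE t f z : (t *: f : test R) z = t * f z. Proof. by []. Qed.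

Lemma test_continuous f : continuous f.
Proof. exact: of_class_C_continuous ((testP f).1 0%N). Qed.

Lemma test_Dx_is_derive f z : is_derive z ex (f : R * R -> R) (test_Dx f z).
Proof. by have [_ dx _ _ _] := (testP f).1 1%N; split. Qed.

Lemma test_Dy_is_derive f z : is_derive z ey (f : R * R -> R) (test_Dy f z).
Proof. by have [_ _ dy _ _] := (testP f).1 1%N; split. Qed.

Lemma test_DxD : {morph test_Dx : f g / f + g}.
Proof.
move=> f g; apply: val_inj; apply/funext => z.
by have [_] := is_deriveD (test_Dx_is_derive f z) (test_Dx_is_derive g z).
Qed.

Lemma test_DyD : {morph test_Dy : f g / f + g}.
Proof.
move=> f g; apply: val_inj; apply/funext => z.
by have [_] := is_deriveD (test_Dy_is_derive f z) (test_Dy_is_derive g z).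
Qed.

Lemma test_DxZ t f : test_Dx (t *: f) = t *: test_Dx f.
Proof.
apply: val_inj; apply/funext => z.
by have [_] := is_deriveZ t (test_Dx_is_derive f z).
Qed.

Lemma test_DyZ t f : test_Dy (t *: f) = t *: test_Dy f.
Proof.
apply: val_inj; apply/funext => z.
by have [_] := is_deriveZ t (test_Dy_is_derive f z).
Qed.

Lemma test_MxD : {morph test_Mx : f g / f + g}.
Proof. by move=> f g; apply: val_inj; apply/funext => z; exact: mulrDr. Qed.

Lemma test_MyD : {morph test_My : f g / f + g}.
Proof. by move=> f g; apply: val_inj; apply/funext => z; exact: mulrDr. Qed.

Lemma test_MxZ t f : test_Mx (t *: f) = t *: test_Mx f.
Proof. by apply: val_inj; apply/funext => z; exact: mulrCA. Qed.

Lemma test_MyZ t f : test_My (t *: f) = t *: test_My f.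
Proof. by apply: val_inj; apply/funext => z; exact: mulrCA. Qed.

Lemma test_DyDx f : test_Dy (test_Dx f) = test_Dx (test_Dy f).
Proof.
apply: val_inj => /=; have [_ fx fy [_ _ fxy _ cxy] [_ fyx _ cyx _]] := (testP f).1 2%N.
exact (derive_exey fx fy fxy fyx cxy cyx).
Qed.

Lemma test_DxMx f : test_Dx (test_Mx f) = f + test_Mx (test_Dx f).
Proof.
apply: val_inj; apply/funext => z.
have [_] := is_deriveM_fun (is_derive_fst_x z) (test_Dx_is_derive f z).
by rewrite mulr1 addrC.
Qed.

Lemma test_DyMy f : test_Dy (test_My f) = f + test_My (test_Dy f).
Proof.
apply: val_inj; apply/funext => z.
have [_] := is_deriveM_fun (is_derive_snd_y z) (test_Dy_is_derive f z).
by rewrite mulr1 addrC.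
Qed.

Lemma test_DxMy f : test_Dx (test_My f) = test_My (test_Dx f).
Proof.
apply: val_inj; apply/funext => z.
have [_] := is_deriveM_fun (is_derive_snd_x z) (test_Dx_is_derive f z).
by rewrite mulr0 addr0.
Qed.

Lemma test_DyMx f : test_Dy (test_Mx f) = test_Mx (test_Dy f).
Proof.
apply: val_inj; apply/funext => z.
have [_] := is_deriveM_fun (is_derive_fst_y z) (test_Dy_is_derive f z).
by rewrite mulr0 addr0.
Qed.

Definition gauss (z : R * R) : R := expR (z.1 ^+ 2 + z.2 ^+ 2).

Lemma sqr_norm_continuous : continuous (fun z : R * R => z.1 ^+ 2 + z.2 ^+ 2).
Proof.
by move=> z; apply: cvgD; apply: cvgM; first [exact: cvg_fst|exact: cvg_snd].
Qed.

Lemma gauss_continuous : continuous gauss.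
Proof.
move=> z; apply: (continuous_comp (@sqr_norm_continuous z)).
exact: continuous_expR.
Qed.

Lemma is_derive_gauss_slice (x c : R) :
  is_derive x 1 (fun t => expR (t ^+ 2 + c)) (2 * x * expR (x ^+ 2 + c)).
Proof.
have D1 : is_derive x 1 (fun t : R => t ^+ 2 + c) (2 * x).
  rewrite -[2 * x]addr0; apply: is_deriveD.
  have := is_deriveM_fun (is_derive_id x (1 : R)) (is_derive_id x 1).
  by rewrite mulr1 -mulr2n mulr_natl.
have := @is_derive1_comp R expR (fun t => t ^+ 2 + c) x _ _
  (is_derive_expR _) D1.
by rewrite mulrC.
Qed.

Lemma is_derive_gauss_x z : is_derive z ex gauss (2 * z.1 * gauss z).
Proof.
case: z => x y; apply: (is_derive_slice_x gauss x y _).2.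
exact (is_derive_gauss_slice x (y ^+ 2)).
Qed.

Lemma is_derive_gauss_y z : is_derive z ey gauss (2 * z.2 * gauss z).
Proof.
case: z => x y; apply: (is_derive_slice_y gauss x y _).2.
have := is_derive_gauss_slice y (x ^+ 2).
rewrite (_ : (fun t => _) = (fun t => gauss (x, t))).
  by rewrite /gauss/= [y ^+ 2 + _]addrC.
by apply/funext => t; rewrite /gauss/= addrC.
Qed.

Definition test_ip f g : R := \int[dsigma R]_z (f z * g z * gauss z).

Lemma test_mul_continuous f g : continuous (fun z => f z * g z * gauss z).
Proof.
move=> z; apply: cvgM; last exact: gauss_continuous.
by apply: cvgM; exact: test_continuous.
Qed.

Lemma test_mul_box_supported f g :
  exists r, box_supported r (fun z => f z * g z * gauss z).
Proof.
have [_ [r fr]] := testP f.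
by exists r => z rz; rewrite fr// !mul0r.
Qed.

Lemma test_mul_integrable f g : (dsigma R).-integrable [set: plane R]
  (EFin \o (fun z : plane R => f z * g z * gauss z)).
Proof.
have [r fgr] := test_mul_box_supported f g.
exact: continuous_box_integrable (@test_mul_continuous f g) fgr.
Qed.

Lemma test_ipC f g : test_ip f g = test_ip g f.
Proof. by apply: eq_Rintegral => z _; rewrite (mulrC (f z)). Qed.

Lemma test_ipDl f g h : test_ip (f + g) h = test_ip f h + test_ip g h.
Proof.
rewrite /test_ip -RintegralD//; try exact: test_mul_integrable.
by apply: eq_Rintegral => z _; rewrite -!mulrDl.
Qed.

Lemma test_ipZl t f g : test_ip (t *: f) g = t * test_ip f g.
Proof.
rewrite /test_ip -RintegralZl//; last exact: test_mul_integrable.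
by apply: eq_Rintegral => z _; rewrite !mulrA.
Qed.

Lemma test_ip_ge0 f : 0 <= test_ip f f.
Proof.
apply: Rintegral_ge0 => z _; rewrite mulr_ge0 ?expR_ge0//.
by rewrite -expr2 sqr_ge0.
Qed.

(** The integral of the [x]-derivative of [f g gauss] is zero; the term [2 x] comes from
    differentiating the weight. *)
Lemma test_ip_Dx f g : test_ip (test_Dx f) g = - test_ip f (test_Dx g + 2 *: test_Mx g).
Proof.
apply/eqP; rewrite -addr_eq0 /test_ip -RintegralD//; try exact: test_mul_integrable.
have [r fgr] := test_mul_box_supported f g.
apply/eqP; apply: (integral_derive_x _ _ fgr) => [z|z].
  by apply: cvgD; exact: test_mul_continuous.
have Dfg := is_deriveM_fun (test_Dx_is_derive f z) (test_Dx_is_derive g z).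
apply: (is_derive_eq (is_deriveM_fun Dfg (is_derive_gauss_x z))).
by rewrite testDE testZE /=; ring.
Qed.

Lemma test_ip_Dy f g : test_ip (test_Dy f) g = - test_ip f (test_Dy g + 2 *: test_My g).
Proof.
apply/eqP; rewrite -addr_eq0 /test_ip -RintegralD//; try exact: test_mul_integrable.
have [r fgr] := test_mul_box_supported f g.
apply/eqP; apply: (integral_derive_y _ _ fgr) => [z|z].
  by apply: cvgD; exact: test_mul_continuous.
have Dfg := is_deriveM_fun (test_Dy_is_derive f z) (test_Dy_is_derive g z).
apply: (is_derive_eq (is_deriveM_fun Dfg (is_derive_gauss_y z))).
by rewrite testDE testZE /=; ring.
Qed.

End test_operators.

(* Unification would otherwise unfold the operators down to the functions. *)
#[local] Opaque test_Dx test_Dy test_Mx test_My test_ip.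

(** * Complex test functions as pairs, and coercivity of the tested operator *)

Section complex_test_functions.
Context (R : realType).
Notation ctest := (test R * test R)%type.
Implicit Types (v w : ctest).

(** The real part of the Hermitian product of [v.1 + i v.2] and [w.1 + i w.2] with weight
    [e^{|z|^2}]. *)
Definition ct_ip v w : R := test_ip v.1 w.1 + test_ip v.2 w.2.

Definition ct_dbar v : ctest :=
  (2^-1 *: (test_Dx v.1 - test_Dy v.2), 2^-1 *: (test_Dx v.2 + test_Dy v.1)).

(* [- (d/dz + conj z)], the adjoint of [dbar] for the weight [e^{|z|^2}]. *)
Definition ct_adj v : ctest :=
  (- (2^-1 *: (test_Dx v.1 + test_Dy v.2)) - test_Mx v.1 - test_My v.2,
   - (2^-1 *: (test_Dx v.2 - test_Dy v.1)) - test_Mx v.2 + test_My v.1).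

Definition ct_mul (c1 c2 : R) v : ctest :=
  (c1 *: v.1 - c2 *: v.2, c1 *: v.2 + c2 *: v.1).

Lemma ct_ipC v w : ct_ip v w = ct_ip w v.
Proof. by rewrite /ct_ip test_ipC (test_ipC v.2). Qed.

Lemma ct_ipDl v w u : ct_ip (v + w) u = ct_ip v u + ct_ip w u.
Proof. by rewrite /ct_ip /= !test_ipDl addrACA. Qed.

Lemma ct_ipZl t v w : ct_ip (t *: v) w = t * ct_ip v w.
Proof. by rewrite /ct_ip /= !test_ipZl mulrDr. Qed.

Lemma ct_ip_ge0 v : 0 <= ct_ip v v.
Proof. by rewrite addr_ge0 ?test_ip_ge0. Qed.

Lemma testN_scale (f : test R) : - f = -1 *: f.
Proof. by rewrite scaleN1r. Qed.

Lemma test_ipDr (f g h : test R) : test_ip f (g + h) = test_ip f g + test_ip f h.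
Proof. by rewrite test_ipC test_ipDl test_ipC (test_ipC h). Qed.

Lemma test_ipZr t (f g : test R) : test_ip f (t *: g) = t * test_ip f g.
Proof. by rewrite test_ipC test_ipZl test_ipC. Qed.

Lemma ct_dbarD : {morph ct_dbar : v w / v + w}.
Proof.
move=> v w; congr pair; rewrite /= test_DxD test_DyD -scalerDr; congr (_ *: _).
  by rewrite opprD addrACA.
by rewrite addrACA.
Qed.

Lemma ct_dbarZ t v : ct_dbar (t *: v) = t *: ct_dbar v.
Proof.
congr pair; rewrite /= test_DxZ test_DyZ scalerA mulrC -scalerA; congr (_ *: _).
  by rewrite scalerBr.
by rewrite scalerDr.
Qed.

Lemma ct_adjP v w : ct_ip (ct_dbar v) w = ct_ip v (ct_adj w).
Proof.
rewrite /ct_ip /= !testN_scale !(test_ipZl, test_ipDl, test_ipZr, test_ipDr, test_ip_Dx, test_ip_Dy).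
do ![move: (test_ip _ _) => ?].
by field.
Qed.

(** The second-order terms cancel by symmetry of mixed derivatives; what survives is
    [dbar (conj z v) - conj z dbar v = v]. *)
Lemma ct_comm v : ct_adj (ct_dbar v) = ct_dbar (ct_adj v) + v.
Proof.
case: v => p q; rewrite /ct_adj /ct_dbar /= !testN_scale.
congr pair; rewrite /=;
  rewrite !(test_DxZ, test_DyZ) !(test_DxD, test_DyD) !(test_DxZ, test_DyZ);
  rewrite !(test_DxD, test_DyD) !(test_DxZ, test_DyZ);
  rewrite !(test_MxZ, test_MyZ) !(test_MxD, test_MyD) !(test_MxZ, test_MyZ);
  rewrite !(test_DxMx, test_DxMy, test_DyMx, test_DyMy) !test_DyDx;
  apply: test_ext => z; rewrite !(testDE, testZE, testNE);
  do ![move: (test_val _ z) => ?]; by field.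
Qed.

Lemma ct_mul_adj c1 c2 v w : ct_ip (ct_mul c1 c2 v) w = ct_ip v (ct_mul c1 (- c2) w).
Proof.
rewrite /ct_ip /= !testN_scale !(test_ipZl, test_ipDl, test_ipZr, test_ipDr).
do ![move: (test_ip _ _) => ?].
by ring.
Qed.

Lemma ct_mulC c1 c2 d1 d2 v :
  ct_mul c1 c2 (ct_mul d1 d2 v) = ct_mul d1 d2 (ct_mul c1 c2 v).
Proof.
rewrite /ct_mul; congr pair; rewrite [_.1]/= [_.2]/=; apply: test_ext => z;
  rewrite !(testDE, testZE, testNE);
  do ![move: (test_val _ z) => ?]; by ring.
Qed.

Lemma ct_adj_mul c1 c2 v : ct_adj (ct_mul c1 c2 v) = ct_mul c1 c2 (ct_adj v).
Proof.
case: v => p q; rewrite /ct_adj /ct_mul /= !testN_scale.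
congr pair; rewrite /=;
  rewrite !(test_DxD, test_DyD) !(test_DxZ, test_DyZ);
  rewrite !(test_MxD, test_MyD) !(test_MxZ, test_MyZ);
  apply: test_ext => z; rewrite !(testDE, testZE, testNE);
  do ![move: (test_val _ z) => ?]; by field.
Qed.

Definition ct_op k b c1 c2 v : ctest :=
  b *: iter k ct_dbar v + ct_mul c1 c2 v.

Lemma ct_op_coercive k b c1 c2 v : (0 < k)%N ->
  b ^+ 2 * k`!%:R * ct_ip v v <= ct_ip (ct_op k b c1 c2 v) (ct_op k b c1 c2 v).
Proof.
case: k => // k _.
apply: (ladder_coercive ct_ipC ct_ipDl ct_ipZl ct_ip_ge0 ct_dbarD ct_dbarZ ct_adjP ct_comm
  (@ct_mul_adj c1 c2) (@ct_mulC c1 c2 c1 (- c2)) (@ct_adj_mul c1 c2)).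
Qed.

End complex_test_functions.

(** * The weighted space on the complex plane *)

Local Open Scope complex_scope.

Section complex_plane.
Context (R : realType).
Implicit Types (f u : R[i] -> R[i]) (p : R * R).

Lemma toCK p : ofC (toC p) = p. Proof. by case: p. Qed.

Lemma cabs_sqr (z : R[i]) : cabs z ^+ 2 = complex.Re z ^+ 2 + complex.Im z ^+ 2.
Proof.
case: z => x y; rewrite /cabs normc_def /= sqr_sqrtr//.
by rewrite addr_ge0 ?sqr_ge0.
Qed.

(** The square root of the weight. Multiplying test functions by it and dividing [f] by it turns
    both weighted spaces into plain L^2 without changing their pairing. *)
Definition half_gauss p : R := expR ((p.1 ^+ 2 + p.2 ^+ 2) / 2).

Lemma half_gauss_gt0 p : 0 < half_gauss p. Proof. exact: expR_gt0. Qed.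

Lemma half_gauss_sqr p : half_gauss p ^+ 2 = gauss p.
Proof. by rewrite /half_gauss /gauss expr2 -expRD -splitr. Qed.

Lemma half_gauss_continuous : continuous half_gauss.
Proof.
move=> z; apply: (@continuous_comp _ _ _
  (fun p : R * R => (p.1 ^+ 2 + p.2 ^+ 2) / 2) expR); last exact: continuous_expR.
by apply: cvgM; [exact: sqr_norm_continuous|exact: cvg_cst].
Qed.

Lemma weighted_sqnormE f : weighted_sqnorm f =
  (\int[dsigma R]_p ((re_part f p / half_gauss p) ^+ 2 +
                     (im_part f p / half_gauss p) ^+ 2)%:E)%E.
Proof.
apply: eq_integral => p _; congr EFin.
rewrite !cabs_sqr /= expRN -/(gauss p) -half_gauss_sqr.
by rewrite !exprMn exprVn mulrDl.
Qed.

Lemma half_gauss_div_measurable (g : plane R -> R) :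
  measurable_fun setT g -> measurable_fun setT (fun p : plane R => g p / half_gauss p).
Proof.
move=> mg; apply: measurable_funM => //.
apply: continuous_measurable_plane => z; apply: cvgV; last exact: half_gauss_continuous.
by rewrite gt_eqF// half_gauss_gt0.
Qed.

Lemma weighted_L2fun f : Cmeasurable f -> (weighted_sqnorm f < +oo)%E ->
  L2fun (dsigma R) (fun p => re_part f p / half_gauss p) /\
  L2fun (dsigma R) (fun p => im_part f p / half_gauss p).
Proof.
move=> [mr mi]; rewrite weighted_sqnormE => fin.
have mr' := half_gauss_div_measurable mr; have mi' := half_gauss_div_measurable mi.
split; split => //; apply: le_lt_trans fin; apply: ge0_le_integral => //.
- by move=> p _; rewrite lee_fin sqr_ge0.
- by apply/measurable_EFinP; exact: measurable_funX.
- by apply/measurable_EFinP; apply: measurable_funD; exact: measurable_funX.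
- by move=> p _; rewrite lee_fin lerDl sqr_ge0.
- by move=> p _; rewrite lee_fin sqr_ge0.
- by apply/measurable_EFinP; exact: measurable_funX.
- by apply/measurable_EFinP; apply: measurable_funD; exact: measurable_funX.
- by move=> p _; rewrite lee_fin lerDr sqr_ge0.
Qed.

Lemma weighted_sqnorm_dot f (F1 F2 : plane R -> R) :
  (forall p, re_part f p = F1 p * half_gauss p) ->
  (forall p, im_part f p = F2 p * half_gauss p) ->
  L2fun (dsigma R) F1 -> L2fun (dsigma R) F2 ->
  weighted_sqnorm f = (dot (dsigma R) F1 F1 + dot (dsigma R) F2 F2)%:E.
Proof.
move=> f1 f2 s1 s2; rewrite EFinD !EFin_dot// weighted_sqnormE.
transitivity (\int[dsigma R]_p ((F1 p ^+ 2)%:E + (F2 p ^+ 2)%:E))%E.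
  apply: eq_integral => p _.
  by rewrite f1 f2 !mulfK ?(gt_eqF (half_gauss_gt0 p))// EFinD.
rewrite ge0_integralD//.
- by move=> p _; rewrite lee_fin sqr_ge0.
- by apply/measurable_EFinP; apply: measurable_funX; exact: s1.1.
- by move=> p _; rewrite lee_fin sqr_ge0.
- by apply/measurable_EFinP; apply: measurable_funX; exact: s2.1.
Qed.

Lemma weighted_L2loc f : Cmeasurable f -> (weighted_sqnorm f < +oo)%E -> L2loc f.
Proof.
move=> mf; have [mr mi] := mf; rewrite weighted_sqnormE => fin; split => // K cK.
have mK := compact_measurable_plane cK.
have [r Kr] : exists r, forall z, K z -> `|z| <= r.
  have [M [_ MK]] := compact_bounded cK.
  by exists (`|M| + 1); apply: MK; rewrite (le_lt_trans (ler_norm _))// ltrDl.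
(* On a compact set the weight is bounded, so [|f|^2] is at most [C^2] times the weighted
   integrand. *)
have [C Cg] := continuous_bounded_cube r half_gauss_continuous.
have mr' := half_gauss_div_measurable mr; have mi' := half_gauss_div_measurable mi.
pose G p := (re_part f p / half_gauss p) ^+ 2 + (im_part f p / half_gauss p) ^+ 2.
have G0 p : 0 <= G p by rewrite addr_ge0 ?sqr_ge0.
have mG : measurable_fun [set: plane R] (EFin \o G).
  by apply/measurable_EFinP; apply: measurable_funD; exact: measurable_funX.
apply: (@le_lt_trans _ _ (\int[dsigma R]_(p in K) ((C ^+ 2)%:E * (G p)%:E))%E).
  apply: ge0_le_integral => //.
  - by move=> p _; rewrite lee_fin sqr_ge0.
  - apply/measurable_EFinP; apply: measurable_funTS.
    under eq_fun do rewrite cabs_sqr.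
    by apply: measurable_funD; exact: measurable_funX.
  - apply: measurable_funTS; apply/measurable_EFinP.
    by apply: measurable_funM => //; exact/measurable_EFinP.
  - move=> p Kp; rewrite -EFinM lee_fin cabs_sqr.
    have hp := half_gauss_gt0 p.
    rewrite -/(re_part f p) -/(im_part f p).
    have -> : re_part f p ^+ 2 + im_part f p ^+ 2 = half_gauss p ^+ 2 * G p.
      by rewrite /G; field; rewrite gt_eqF.
    have hC : half_gauss p <= C.
      by have := Cg p (Kr _ Kp); rewrite gtr0_norm.
    apply: ler_wpM2r; first exact: G0.
    by rewrite ler_pXn2r// nnegrE ltW// (lt_le_trans hp).
rewrite ge0_integralZl//; last 3 first.
- exact: measurable_funTS.
- by move=> p _; rewrite lee_fin.
- by rewrite lee_fin sqr_ge0.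
have intK : (\int[dsigma R]_(p in K) (G p)%:E < +oo)%E.
  apply: le_lt_trans fin; apply: ge0_subset_integral => //.
  by move=> p _; rewrite lee_fin.
by rewrite lte_mul_pinfty// ?lee_fin ?sqr_ge0//.
Qed.

End complex_plane.

(** * From complex-valued test functions to pairs of real ones *)

Section ctest_functions.
Context (R : realType).
Notation ctest := (test R * test R)%type.
Implicit Types (v w : ctest) (f : test R).
Local Notation mu := (dsigma R).

Lemma half_test_L2fun f : L2fun mu (fun p : plane R => f p * half_gauss p).
Proof.
apply: L2funP.
  apply: continuous_measurable_plane => z; apply: cvgM.
    exact: test_continuous.
  exact: half_gauss_continuous.
have := test_mul_integrable f f; apply: eq_integrable => // p _ /=.
by rewrite exprMn half_gauss_sqr expr2.
Qed.

Lemma dot_half_test (f g : test R) :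
  dot mu (fun p => f p * half_gauss p) (fun p => g p * half_gauss p) = test_ip f g.
Proof.
apply: eq_Rintegral => p _; rewrite -half_gauss_sqr.
by move: (f p) (g p) (half_gauss p) => a b c; ring.
Qed.

Lemma ct_dbar_mul c1 c2 v : ct_dbar (ct_mul c1 c2 v) = ct_mul c1 c2 (ct_dbar v).
Proof.
case: v => p q; rewrite /ct_dbar /ct_mul /= !testN_scale.
congr pair; rewrite /= !(test_DxD, test_DyD) !(test_DxZ, test_DyZ);
  apply: test_ext => z; rewrite !(testDE, testZE, testNE);
  do ![move: (test_val _ z) => ?]; by field.
Qed.

Lemma ct_mulD c1 c2 : {morph @ct_mul R c1 c2 : v w / v + w}.
Proof.
move=> v w; rewrite /ct_mul; congr pair; rewrite !scalerDr.
  by rewrite opprD addrACA.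
by rewrite addrACA.
Qed.

Lemma ct_mulZ c1 c2 t v : ct_mul c1 c2 (t *: v) = t *: ct_mul c1 c2 v.
Proof.
rewrite /ct_mul; congr pair; rewrite !(scalerA, mulrC _ t) -!scalerA.
  by rewrite scalerBr.
by rewrite scalerDr.
Qed.

Lemma iter_ct_dbarD k : {morph iter k (@ct_dbar R) : v w / v + w}.
Proof. by elim: k => // k IH v w /=; rewrite IH ct_dbarD. Qed.

Lemma iter_ct_dbarZ k t v :
  iter k (@ct_dbar R) (t *: v) = t *: iter k (@ct_dbar R) v.
Proof. by elim: k => // k IH /=; rewrite IH ct_dbarZ. Qed.

Lemma ct_opD k b c1 c2 : {morph @ct_op R k b c1 c2 : v w / v + w}.
Proof.
by move=> v w; rewrite /ct_op iter_ct_dbarD ct_mulD scalerDr addrACA.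
Qed.

Lemma ct_opZ k b c1 c2 t v : ct_op k b c1 c2 (t *: v) = t *: ct_op k b c1 c2 v.
Proof.
by rewrite /ct_op iter_ct_dbarZ ct_mulZ scalerDr !scalerA mulrC.
Qed.

Lemma ct_op_mul k b c1 c2 d1 d2 v :
  ct_op k b c1 c2 (ct_mul d1 d2 v) = ct_mul d1 d2 (ct_op k b c1 c2 v).
Proof.
rewrite /ct_op ct_mulD ct_mulZ ct_mulC; congr (_ *: _ + _).
by elim: k => // k IH /=; rewrite IH ct_dbar_mul.
Qed.

Lemma ctest_of (phi : R[i] -> R[i]) : smooth phi -> compactly_supported phi ->
  exists v, forall p, phi (toC p) = (v.1 p +i* v.2 p)%C.
Proof.
move=> sphi cphi.
have [M [_ MK]] := compact_bounded cphi.
have supp p : `|M| + 1 < `|p| -> phi (toC p) = 0.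
  move=> Mp; apply/eqP/negPn/negP => phi0; move: Mp; apply/negP; rewrite -leNgt.
  apply: (MK (`|M| + 1)); first by rewrite (le_lt_trans (ler_norm _))// ltrDl.
  exact: subset_closure.
have t1 : is_test (re_part phi).
  split=> [n|]; first by have [] := sphi n.
  by exists (`|M| + 1) => p Mp; rewrite /re_part supp.
have t2 : is_test (im_part phi).
  split=> [n|]; first by have [] := sphi n.
  by exists (`|M| + 1) => p Mp; rewrite /im_part supp.
exists (mk_test t1, mk_test t2) => p /=; rewrite /re_part /im_part.
by case: (phi _).
Qed.

Lemma dbar_ctest (phi : R[i] -> R[i]) v :
  (forall p, phi (toC p) = (v.1 p +i* v.2 p)%C) ->
  forall p, dbar phi (toC p) = ((ct_dbar v).1 p +i* (ct_dbar v).2 p)%C.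
Proof.
move=> phiv p.
have r1 : re_part phi = v.1 by apply/funext => q; rewrite /re_part phiv.
have r2 : im_part phi = v.2 by apply/funext => q; rewrite /im_part phiv.
rewrite /dbar /partial toCK r1 r2.
(* Writing [2] as the image of a real number lets the division act on real and imaginary parts
   separately. *)
rewrite -[2 : R[i]]/(2%:R) -(rmorph_nat (real_complex R)) -fmorphV.
rewrite /ct_dbar [_.1]/= [_.2]/= !testZE !testDE testNE.
rewrite -[test_Dx v.1 p]/('D_(1, 0) v.1 p) -[test_Dx v.2 p]/('D_(1, 0) v.2 p).
rewrite -[test_Dy v.1 p]/('D_(0, 1) v.1 p) -[test_Dy v.2 p]/('D_(0, 1) v.2 p).
move: ('D_(1, 0) v.1 p) ('D_(1, 0) v.2 p) ('D_(0, 1) v.1 p) ('D_(0, 1) v.2 p).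
move=> a b c d; apply/eqP; rewrite eq_complex /=.
by apply/andP; split; apply/eqP; ring.
Qed.

Lemma iter_dbar_ctest k (phi : R[i] -> R[i]) v :
  (forall p, phi (toC p) = (v.1 p +i* v.2 p)%C) ->
  forall p, iter k (@dbar R) phi (toC p) =
    ((iter k (@ct_dbar R) v).1 p +i* (iter k (@ct_dbar R) v).2 p)%C.
Proof. by move=> phiv; elim: k => // k IH; exact: dbar_ctest. Qed.

Lemma op_ctest k (beta : R) (c : R[i]) (phi : R[i] -> R[i]) v :
  (forall p, phi (toC p) = (v.1 p +i* v.2 p)%C) ->
  let H := ct_op k ((-1) ^+ k * beta) (complex.Re c) (complex.Im c) v in
  forall p, ((-1) ^+ k * beta%:C * iter k (@dbar R) phi (toC p) + c * phi (toC p))%C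
    = (H.1 p +i* H.2 p)%C.
Proof.
move=> phiv H p; rewrite (iter_dbar_ctest k phiv) phiv /H /ct_op.
rewrite [(_ + _).1]/= [(_ + _).2]/= !testDE !testNE !testZE.
have -> : (-1) ^+ k * beta%:C%C = ((-1) ^+ k * beta)%:C%C :> R[i].
  by rewrite rmorphM rmorphXn rmorphN1.
move: ((-1) ^+ k * beta) => b; case: c {H} => c1 c2 /=.
do ![move: (test_val _ p) => ?].
by apply/eqP; rewrite eq_complex /=; apply/andP; split; apply/eqP; ring.
Qed.

End ctest_functions.

Theorem theorem4p1 (R : realType) (k : nat) (c : R[i]) (beta : R)
    (hk : (1 <= k)%N) (hbeta : 1 <= `|beta|)
    (f : R[i] -> R[i]) (hf : L2weighted f) :
  exists u : R[i] -> R[i],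
    [/\ L2weighted u,
        weak_solution k beta c (fun z => beta%:C * f z) u &
        (weighted_sqnorm u <=
           (`|beta| ^+ 2 / (k`!)%:R)%:E * weighted_sqnorm f)%E].
Proof.
have [[[mf1 mf2] _] ffin] := hf.
have [sF1 sF2] := weighted_L2fun (conj mf1 mf2) ffin.
set F1 := (fun p => _) in sF1; set F2 := (fun p => _) in sF2.
pose mu := dsigma R.
pose N := dot mu F1 F1 + dot mu F2 F2.
have N0 : 0 <= N by rewrite addr_ge0 ?dot_ge0.
have fE : weighted_sqnorm f = N%:E.
  apply: (@weighted_sqnorm_dot R f F1 F2) => // p.
    by rewrite /F1 divfK// gt_eqF// half_gauss_gt0.
  by rewrite /F2 divfK// gt_eqF// half_gauss_gt0.
pose V := (test R * test R)%type.
pose H : V -> V := ct_op k ((-1) ^+ k * beta) (complex.Re c) (complex.Im c).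
pose A (v : V) (p : plane R) := (H v).1 p * half_gauss p.
pose B (v : V) (p : plane R) := (H v).2 p * half_gauss p.
(* The real part of the integral of [beta f v]; the minus sign reflects that the weak equation pairs
   without conjugation. *)
pose l (v : V) := beta * (dot mu F1 (fun p => v.1 p * half_gauss p) -
                          dot mu F2 (fun p => v.2 p * half_gauss p)).
have HD v w : H (v + w) = H v + H w by exact: ct_opD.
have HZ t v : H (t *: v) = t *: H v by exact: ct_opZ.
have sH1 (v : V) : L2fun mu (A v) by exact: half_test_L2fun.
have sH2 (v : V) : L2fun mu (B v) by exact: half_test_L2fun.
have AD v w : A (v + w) = (fun p => A v p + A w p).
  by apply/funext => p; rewrite /A HD [_.1]/= testDE mulrDl.
have BD v w : B (v + w) = (fun p => B v p + B w p).
  by apply/funext => p; rewrite /B HD [_.2]/= testDE mulrDl.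
have AZ t v : A (t *: v) = (fun p => t * A v p).
  by apply/funext => p; rewrite /A HZ [_.1]/= testZE mulrA.
have BZ t v : B (t *: v) = (fun p => t * B v p).
  by apply/funext => p; rewrite /B HZ [_.2]/= testZE mulrA.
have lE v : l v = \int[mu]_p (beta * (re_part f p * v.1 p - im_part f p * v.2 p)).
  have s1 := half_test_L2fun v.1; have s2 := half_test_L2fun v.2.
  rewrite /l /dot -RintegralB//; try exact: L2fun_integrableM.
  rewrite -RintegralZl//; last first.
    have := integrableB measurableT (L2fun_integrableM sF1 s1) (L2fun_integrableM sF2 s2).
    by apply: eq_integrable => // p _ /=; rewrite EFinB.
  apply: eq_Rintegral => p _; rewrite /F1 /F2.
  have := half_gauss_gt0 p; move: (half_gauss p) => q q0.
  move: (re_part f p) (im_part f p) (v.1 p) (v.2 p) => x y z w.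
  by field; rewrite gt_eqF.
have half_testD (x y : test R) : (fun p => (x + y) p * half_gauss p) =
    (fun p => x p * half_gauss p + y p * half_gauss p).
  by apply/funext => p; rewrite testDE mulrDl.
have half_testZ t (x : test R) : (fun p => (t *: x) p * half_gauss p) =
    (fun p => t * (x p * half_gauss p)).
  by apply/funext => p; rewrite testZE mulrA.
have lD v w : l (v + w) = l v + l w.
  have [s1 s2] := (half_test_L2fun v.1, half_test_L2fun v.2).
  have [t1 t2] := (half_test_L2fun w.1, half_test_L2fun w.2).
  rewrite /l [_.1]/= [_.2]/= !half_testD ![dot mu F1 _]dotC ![dot mu F2 _]dotC.
  rewrite (dotDl s1 t1 sF1) (dotDl s2 t2 sF2).
  by rewrite opprD addrACA mulrDr.
have lZ t v : l (t *: v) = t * l v.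
  have [s1 s2] := (half_test_L2fun v.1, half_test_L2fun v.2).
  rewrite /l [_.1]/= [_.2]/= !half_testZ ![dot mu F1 _]dotC ![dot mu F2 _]dotC.
  by rewrite (dotZl t s1 sF1) (dotZl t s2 sF2) -mulrBr mulrCA.
have lM v : l v ^+ 2 <= N / k`!%:R * (dot mu (A v) (A v) + dot mu (B v) (B v)).
  rewrite !dot_half_test.
  have := ct_op_coercive ((-1) ^+ k * beta) (complex.Re c) (complex.Im c) v hk.
  rewrite exprMn sqrr_sign mul1r => coer.
  have k0 : 0 < k`!%:R :> R by rewrite ltr0n fact_gt0.
  have Nk0 : 0 <= N / k`!%:R by rewrite divr_ge0.
  apply: le_trans (ler_wpM2l Nk0 coer).
  have -> : N / k`!%:R * (beta ^+ 2 * k`!%:R * ct_ip v v) = beta ^+ 2 * (N * ct_ip v v).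
    by field; rewrite gt_eqF.
  rewrite exprMn ler_wpM2l ?sqr_ge0// /ct_ip -!dot_half_test.
  by apply: dot_cauchy_schwarz2 => //; exact: half_test_L2fun.
have [|g [h [sg sh ghN ghE]]] :=
    @L2_riesz R _ _ mu V A B l (N / k`!%:R) sH1 sH2 AD BD AZ BZ lD lZ _ lM.
  by rewrite divr_ge0.
(* The conjugate is needed because [g A + h B] is the real part of [(g - i h) (A + i B)]. The factor
   [half_gauss] undoes the normalization, so the weighted norm of [u] is the L^2 norm of
   [(g, h)]. *)
pose u (z : R[i]) := (g (ofC z) * half_gauss (ofC z) +i* - (h (ofC z) * half_gauss (ofC z)))%C.
have u1 : re_part u = (fun p => g p * half_gauss p) by apply/funext => -[].
have u2 : im_part u = (fun p => - (h p * half_gauss p)) by apply/funext => -[].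
have sNh : L2fun mu (fun p => -1 * h p) by exact: L2funZ.
have uE : weighted_sqnorm u = (dot mu g g + dot mu h h)%:E.
  rewrite (@weighted_sqnorm_dot R u g (fun p => -1 * h p))//.
  - by congr (_ + _)%:E; apply: eq_Rintegral => p _; rewrite !mulN1r mulrNN.
  - by move=> p; rewrite u1.
  - by move=> p; rewrite u2 mulN1r mulNr.
have mu_ : Cmeasurable u.
  have mhg : measurable_fun [set: plane R] (@half_gauss R).
    by apply: continuous_measurable_plane; exact: half_gauss_continuous.
  split; rewrite ?u1 ?u2.
    by apply: measurable_funM => //; exact: sg.1.
  by apply: measurableT_comp => //; apply: measurable_funM => //; exact: sh.1.
have ufin : (weighted_sqnorm u < +oo)%E by rewrite uE ltry.
have uloc := weighted_L2loc mu_ ufin.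
exists u; split => //.
  split=> // phi sphi cphi.
  have [v phiv] := ctest_of sphi cphi.
  have opE := op_ctest k beta c phiv.
  have key w : \int[mu]_p (g p * A w p + h p * B w p) =
      \int[mu]_p (beta * (re_part f p * w.1 p - im_part f p * w.2 p)).
    by rewrite -lE -ghE RintegralD//; exact: L2fun_integrableM.
  congr (_ +i* _)%C.
    transitivity (\int[mu]_p (g p * A v p + h p * B v p)).
      apply: eq_Rintegral => p _; rewrite /re_part opE /u toCK /A /B /H.
      move: (ct_op _ _ _ _ v) => w /=.
      by move: (w.1 p) (w.2 p) (g p) (h p) (half_gauss p) => *; ring.
    rewrite key; apply: eq_Rintegral => p _; rewrite /re_part /im_part phiv.
    by case: (f (toC p)) => x y /=; ring.
  (* The imaginary part of a number is the real part of its product with [- i], and the operator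
     commutes with that factor. *)
  transitivity (\int[mu]_p (g p * A (ct_mul 0 (-1) v) p +
                            h p * B (ct_mul 0 (-1) v) p)).
    apply: eq_Rintegral => p _; rewrite /im_part opE /u toCK /A /B /H ct_op_mul.
    move: (ct_op _ _ _ _ v) => w.
    rewrite [(ct_mul _ _ _).1]/= [(ct_mul _ _ _).2]/= !testDE !testNE !testZE /=.
    by move: (w.1 p) (w.2 p) (g p) (h p) (half_gauss p) => *; ring.
  rewrite key; apply: eq_Rintegral => p _; rewrite /re_part /im_part phiv.
  rewrite [(ct_mul _ _ _).1]/= [(ct_mul _ _ _).2]/= !testDE !testNE !testZE.
  by case: (f (toC p)) => x y /=; ring.
rewrite uE fE -EFinM lee_fin (le_trans ghN)// mulrAC.
by rewrite ler_wpM2r ?invr_ge0// ler_peMl// exprn_ege1.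
Qed.
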